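(* Let $\Delta\subset\mathbb{C}$ denote the unit disc and let $E=\Delta\times\mathbb{C}^2$ be the trivial vector bundle over $\Delta$. Let $h$ be the singular hermitian metric on $E$ given by $$h=\begin{pmatrix} 1+|z|^2 & z \\ \bar z & |z|^2\end{pmatrix}.$$ Then $h$ is negatively curved in the sense of Griffiths, and the connection matrix of $h$ is given (for $z\neq 0$) by $$\theta^h := h^{-1}\partial h=\begin{pmatrix} \frac1z & 0\\ -\frac{1}{z^2} & \frac1z\end{pmatrix}dz .$$ Hence $\theta^h$ is not locally integrable on $\Delta$, and $\Theta^h:=\bar\partial\theta^h$ is not a (matrix of) current(s) with measure coefficients on $\Delta$.
   Context: A singular hermitian metric $h$ on a holomorphic vector bundle $E \to X$ is a measurable map from $X$ to the space of non-negative (finite, possibly degenerate) hermitian forms on the fibers of $E$. Such an $h$ is called negatively curved in the sense of Griffiths if, for every holomorphic section $u$ of $E$ over any open subset of $X$, the function $\|u\|_h^2$ is plurisubharmonic. Sections of the trivial bundle are regarded as column vectors of functions, with $(s,t)_h=t^*hs$ and $\|s\|_h^2=(s,s)_h$, where $t^*$ is the conjugate transpose. In $\Theta^h=\bar\partial\theta^h$ the operator $\bar\partial$ is applied entrywise in the sense of currents on $\Delta$. The locally integrable entries define currents in the usual way; the non-integrable function $-1/z^2$ is regarded as a distribution on $\Delta$ through its principal value, i.e. as the distributional derivative $\frac{\partial}{\partial z}\left(\frac1z\right)$ of the locally integrable function $1/z$. A current has measure coefficients if its coefficients are complex (locally finite) Borel measures. *)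

(* Defs.v *)
From HB Require Import structures.
From mathcomp Require Import all_boot all_order all_algebra.
From mathcomp Require Import all_classical all_reals all_analysis.
From mathcomp Require Import complex sesquilinear spectral.

Set Implicit Arguments.
Unset Strict Implicit.
Unset Printing Implicit Defensive.

Import Order.TTheory GRing.Theory Num.Theory.
Import numFieldNormedType.Exports.

Local Open Scope classical_set_scope.
Local Open Scope ring_scope.
Local Open Scope complex_scope.
Local Open Scope sesquilinear_scope.

(* The topology of R[i] is the one of the normed module R[i]^o over R[i], with
   the complex modulus as norm; hence the casts to R[i]^o below. For functions
   on R[i]^o, [derivable f z 1] is complex differentiability at z.
   Functions on an open subset of the plane are total functions on R[i] whose
   values outside that subset play no role. *)

Definition unit_disc {R : realType} : set R[i]^o := [set z | `|z| < 1].

Definition mx2 (T : nzRingType) (a b c d : T) : 'M[T]_2 :=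
  \matrix_(i < 2, j < 2) nth 0 (nth [::] [:: [:: a; b]; [:: c; d]] i) j.

(* Measure theory in the plane is done in R * R with the product sigma-algebra,
   which is its Borel sigma-algebra, through (x, y) |-> x + iy. *)
Section Plane.
Variable R : realType.
Local Notation plane := (measurableTypeR R * measurableTypeR R)%type.
Implicit Types (f : R[i] -> R[i]) (A X : set R[i]^o).

Definition to_complex (p : plane) : R[i] := p.1 +i* p.2.

Definition to_plane A : set plane := [set p | A (to_complex p)].

Definition plane_measure : {measure set plane -> \bar R} :=
  (@lebesgue_measure R \x @lebesgue_measure R)%E.

Definition re_part f (p : plane) : R := complex.Re (f (to_complex p)).
Definition im_part f (p : plane) : R := complex.Im (f (to_complex p)).

Definition cmeasurable A f :=
  measurable_fun (to_plane A) (re_part f) /\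
  measurable_fun (to_plane A) (im_part f).

Definition cintegrable (m : {measure set plane -> \bar R}) A f :=
  m.-integrable (to_plane A) (EFin \o re_part f) /\
  m.-integrable (to_plane A) (EFin \o im_part f).

Definition cintegral (m : {measure set plane -> \bar R}) A f : R[i] :=
  Rintegral m (to_plane A) (re_part f) +i* Rintegral m (to_plane A) (im_part f).

Definition clocally_integrable X f :=
  forall K : set R[i]^o, compact K -> K `<=` X -> cintegrable plane_measure K f.

(* Real differentiation in the direction v (v = 1 or v = 'i), and the Wirtinger
   operators d/dz and d/dzbar. *)
Definition along f (z v : R[i]) (t : R) : R[i] := f (z + t%:C * v).

Definition rderivable f (v z : R[i]) :=
  derivable (@complex.Re R \o along f z v) 0 1 /\
  derivable (@complex.Im R \o along f z v) 0 1.

Definition rderive (v : R[i]) f (z : R[i]) : R[i] :=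
  derive1 (@complex.Re R \o along f z v) 0 +i*
  derive1 (@complex.Im R \o along f z v) 0.

Definition wirtinger_dz f (z : R[i]) : R[i] :=
  (rderive 1 f z - 'i * rderive 'i f z) / 2.

Definition wirtinger_dzbar f (z : R[i]) : R[i] :=
  (rderive 1 f z + 'i * rderive 'i f z) / 2.

Definition holomorphic X (f : R[i]^o -> R[i]^o) :=
  forall z, X z -> derivable f z 1.

(* All iterated partial derivatives exist and are continuous; the word w lists
   the variables, [true] standing for x and [false] for y. *)
Definition smooth f :=
  forall w : seq bool,
    let g := foldr (fun b : bool => rderive (if b then 1 else 'i)) f w in
    [/\ continuous (g : R[i]^o -> R[i]^o),
        forall z, rderivable g 1 z & forall z, rderivable g 'i z].

Definition test_function X f :=
  smooth f /\
  exists K : set R[i]^o,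
    [/\ compact K, K `<=` X & forall z, ~ K z -> f z = 0].

(* Distributions are seen as functionals on test functions; continuity is not
   recorded in the type, as they are only built from locally integrable
   functions by distributional differentiation. The coefficient of a (1,0)-current
   is taken with respect to dz, the one of a (1,1)-current with respect to
   dzbar /\ dz, so that dbar (T dz) = (dT/dzbar) dzbar /\ dz. *)
Definition distribution := (R[i] -> R[i]) -> R[i].

Definition distr_of_fun X f : distribution :=
  fun phi => cintegral plane_measure X (fun z => f z * phi z).

Definition distr_dz (T : distribution) : distribution :=
  fun phi => - T (wirtinger_dz phi).

Definition distr_dzbar (T : distribution) : distribution :=
  fun phi => - T (wirtinger_dzbar phi).

(* A locally finite complex Borel measure on X is of the form
   m 0 + i m 1 - m 2 - i m 3 with m k >= 0 finite on the compact subsets of X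
   (Jordan decomposition of the real and imaginary parts). *)
Definition has_measure_coefficient X (T : distribution) :=
  exists2 m : 'I_4 -> {measure set plane -> \bar R},
    forall k (K : set R[i]^o), compact K -> K `<=` X ->
      (m k (to_plane K) < +oo)%E &
    forall phi, test_function X phi ->
      T phi = \sum_(k < 4) 'i ^+ k * cintegral (m k) X phi.

End Plane.

Section Plurisubharmonic.
Variables (R : realType) (V : normedModType R[i]).

Definition expi (t : R) : R[i] := cos t +i* sin t.

Definition circle_mean (u : V -> \bar R) (a b : V) : \bar R :=
  (((2 * pi)^-1)%:E *
    \int[@lebesgue_measure R]_(t in `[0%R, (2 * pi)%R]) u (a + expi t *: b)%R)%E.

(* Upper semicontinuous with values in [-oo, +oo[, and satisfying the sub-mean
   value inequality on each closed disc of a complex line contained in X. *)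
Definition plurisubharmonic (X : set V) (u : V -> \bar R) :=
  [/\ forall x, X x -> (u x < +oo)%E,
      forall x (c : R), X x -> (u x < c%:E)%E ->
        \forall y \near x, X y -> (u y < c%:E)%E &
      forall a b : V, (forall c : R[i], `|c| <= 1 -> X (a + c *: b)) ->
        (u a <= circle_mean u a b)%E].

End Plurisubharmonic.

(* Metrics on the trivial bundle of rank r over an open subset X of the complex
   plane; sections are column vectors. *)
Section Metric.
Variables (R : realType) (r : nat).
Implicit Types (X : set R[i]^o) (h : R[i] -> 'M[R[i]]_r).

Definition hform (H : 'M[R[i]]_r) (s t : 'cV[R[i]]_r) : R[i] :=
  (t ^t* *m H *m s) 0 0.

Definition singular_hermitian_metric X h :=
  (forall z, X z -> h z \is hermsymmx /\ forall s, 0 <= hform (h z) s s) /\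
  (forall i j, cmeasurable X (fun z => h z i j)).

Definition griffiths_negative X h :=
  forall (U : set R[i]^o) (u : R[i] -> 'cV[R[i]]_r),
    open U -> U `<=` X -> (forall i, holomorphic U (fun z => u z i 0)) ->
    plurisubharmonic U
      (fun z : R[i]^o => (complex.Re (hform (h z) (u z) (u z)))%:E).

(* The coefficient of dz in h^-1 (dh). *)
Definition connection_matrix h (z : R[i]) : 'M[R[i]]_r :=
  invmx (h z) *m \matrix_(i, j) wirtinger_dz (fun w => h w i j) z.

Definition locally_integrable_mx X (theta : R[i] -> 'M[R[i]]_r) :=
  forall i j, clocally_integrable X (fun z => theta z i j).

Definition has_measure_coefficients X
    (Theta : 'I_r -> 'I_r -> distribution R) :=
  forall i j, has_measure_coefficient X (Theta i j).

Definition dbar_mx (T : 'I_r -> 'I_r -> distribution R) i j :=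
  distr_dzbar (T i j).

End Metric.

(* The current on X defined by theta dz, when all the entries of theta but the
   lower left one are locally integrable and the latter is the principal value
   of -1/z^2, that is the distributional derivative (d/dz) (1/z). *)
Definition pv_current_mx (R : realType) (X : set R[i]^o)
    (theta : R[i] -> 'M[R[i]]_2) (i j : 'I_2) : distribution R :=
  if (i == 1) && (j == 0) then distr_dz (distr_of_fun X (fun z => z^-1))
  else distr_of_fun X (fun z => theta z i j).

(* Main.v *)
(* Writing h(u,u) = |z u_1|^2 + |u_1 + z u_2|^2 shows that the metric is a sum of squared moduli of
   holomorphic functions, hence plurisubharmonic by the mean value property, which follows here from
   Goursat's theorem for rectangles applied to w |-> f(a + b exp w). The entry -1/z^2 of the
   connection matrix is not integrable at 0, as the integral of its modulus over the box
   [s, 2s] x [0, s/2] is bounded away from 0 independently of s. Finally the curvature current has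
   the entry (d/dzbar)(d/dz)(1/z), whose value on the test function z chi(r - |z|^2), where
   chi(x) = exp(-1/x) for x > 0 and 0 otherwise, is - pi chi(r), although this function is bounded
   by sqrt(r) chi(r): no measure behaves like this for all small r. *)
Require Import Defs.
From mathcomp Require Import all_boot all_order all_algebra.
From mathcomp Require Import all_classical all_reals all_analysis.
From mathcomp Require Import complex.
From mathcomp Require Import measurable_realfun ring lra.
Import Order.TTheory GRing.Theory Num.Theory.
Import numFieldNormedType.Exports.
Local Open Scope ring_scope.
Local Open Scope complex_scope.

Set Implicit Arguments.
Unset Strict Implicit.
Unset Printing Implicit Defensive.

(** * Topology of the complex numbers *)

Section ComplexTopology.
Variable R : realType.
Implicit Types (z w : R[i]).
Local Open Scope classical_set_scope.
Local Open Scope ring_scope.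
Local Open Scope complex_scope.

(** As a distribution, (d/dzbar)(d/dz)(1/z) is pi times the z-derivative of the Dirac mass at 0: it
    has order one, whereas a measure has order zero. The test function z chi(r - |z|^2) tells them
    apart, because its z-derivative at 0 is chi(r) while its size is smaller by a factor sqrt(r).
    The tiny number chi(r) occurs on both sides of the comparison and cancels. The factor z also
    makes the pairing computable by hand: the mixed derivative of the test function is z times a
    radial function, so the pole of 1/z disappears, and the remaining radial integrand is an exact
    derivative in s = |z|^2. Holomorphy means complex differentiability at each point, with no
    continuity of the derivative, so Green's formula cannot be applied directly; hence the bisection
    argument of Goursat. The exponential turns circles into vertical segments, so that rectangles
    suffice. *)

Lemma gt0_complexE (e : R[i]) : 0 < e -> exists2 r : R, 0 < r & e = r%:C.
Proof.
by case: e => a b; rewrite ltcE /= => /andP[/eqP-> ?]; exists a.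
Qed.

Lemma normC_Re z : `|z| = (complex.Re `|z|)%:C.
Proof. by rewrite normc_def. Qed.

Lemma Re_norm_ge0 z : 0 <= complex.Re `|z|.
Proof. by rewrite -ler0c -normC_Re. Qed.

Lemma ltC_norm z (e : R) : (`|z| < e%:C) = (complex.Re `|z| < e).
Proof. by rewrite normC_Re ltcR. Qed.

Lemma normRe_le z : `|complex.Re z| <= complex.Re `|z|.
Proof. by have := normc_ge_Re z; rewrite normC_Re lecR. Qed.

Lemma normIm_le z : `|complex.Im z| <= complex.Re `|z|.
Proof.
have := normRe_le (z * 'i).
rewrite ReiNIm normrN normrM [`|'i|]normc_def /= expr0n expr1n add0r sqrtr1.
by rewrite mulr1 mulr0 subr0.
Qed.

Lemma norm_le_ReIm z : complex.Re `|z| <= `|complex.Re z| + `|complex.Im z|.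
Proof.
rewrite -lecR -normC_Re {1}(complexE z) (le_trans (ler_normD _ _))//.
rewrite rmorphD /= normrM !normc_def /= !expr0n !expr1n add0r sqrtr1 mul1r.
by rewrite !addr0 !sqrtr_sqr.
Qed.

Lemma cvg_complex {T : Type} {F : set_system T} {FF : Filter F} (f : T -> R[i]) z :
  complex.Re (f x) @[x --> F] --> complex.Re z ->
  complex.Im (f x) @[x --> F] --> complex.Im z ->
  (f x : R[i]^o) @[x --> F] --> (z : R[i]^o).
Proof.
move=> /cvgrPdist_lt fr /cvgrPdist_lt fi.
apply/cvgrPdist_lt => _ /gt0_complexE[e e0 ->].
have e2 : 0 < e / 2 by rewrite divr_gt0.
near=> x; rewrite ltC_norm; apply: le_lt_trans (norm_le_ReIm _) _.
rewrite (splitr e) !raddfB; apply: ltrD.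
  by near: x; exact: fr.
by near: x; exact: fi.
Unshelve. all: by end_near. Qed.

Lemma near_norm_lt z (e : R) : 0 < e ->
  \forall w \near (z : R[i]^o), complex.Re `|z - w| < e.
Proof.
move=> e0; apply/nbhs_normP; exists e%:C => /=; first by rewrite ltcR.
by move=> w /=; rewrite -ltC_norm.
Qed.

Lemma continuous_Re : continuous (@complex.Re R : R[i]^o -> R).
Proof.
move=> z; apply/(@cvgrPdist_lt _ R^o _ (nbhs (z : R[i]^o))) => e e0; near=> w.
rewrite -raddfB (le_lt_trans (normRe_le _))//.
by near: w; exact: near_norm_lt.
Unshelve. all: by end_near. Qed.

Lemma continuous_Im : continuous (@complex.Im R : R[i]^o -> R).
Proof.
move=> z; apply/(@cvgrPdist_lt _ R^o _ (nbhs (z : R[i]^o))) => e e0; near=> w.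
rewrite -raddfB (le_lt_trans (normIm_le _))//.
by near: w; exact: near_norm_lt.
Unshelve. all: by end_near. Qed.

Lemma continuous_to_complex : continuous (@to_complex R : R * R -> R[i]^o).
Proof.
by move=> p; apply: cvg_complex; [exact: cvg_fst|exact: cvg_snd].
Qed.

Definition sqnorm z : R := complex.Re z ^+ 2 + complex.Im z ^+ 2.

Lemma sqnormE z : (sqnorm z)%:C = `|z| ^+ 2.
Proof. exact: add_Re2_Im2. Qed.

Lemma continuous_sqnorm : continuous (sqnorm : R[i]^o -> R).
Proof.
move=> z.
have cR : {for z, continuous (@complex.Re R : R[i]^o -> R)} by exact: continuous_Re.
have cI : {for z, continuous (@complex.Im R : R[i]^o -> R)} by exact: continuous_Im.
exact: (@continuousD R R^o _ _ _ _ (continuousM cR cR) (continuousM cI cI)).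
Qed.

Lemma norm_lt_sqnorm z (r : R) : 0 <= r -> (`|z| < r%:C) = (sqnorm z < r ^+ 2).
Proof.
move=> r0; rewrite -ltcR sqnormE rmorphXn /= ltr_sqr// ?nnegrE//.
by rewrite ler0c.
Qed.

Lemma unit_discE z : unit_disc z = (sqnorm z < 1) :> Prop.
Proof.
by rewrite /unit_disc /= -[1 in X in X = _]/(1%:C) norm_lt_sqnorm// expr1n.
Qed.

Lemma open_unit_disc : open (@unit_disc R).
Proof.
rewrite (_ : unit_disc = [set z | sqnorm z < 1]).
  have := @open_comp R[i]^o R sqnorm [set x : R | x < 1]; apply.
    by move=> z _; exact: continuous_sqnorm.
  exact: open_lt.
by apply/funext => z; exact: unit_discE.
Qed.

(** The parameter is the square of the radius, to match the cutoffs in [r - sqnorm z] used for the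
    test functions. *)
Definition disc (r : R) : set R[i]^o := [set z | sqnorm z <= r].

Lemma disc_sub_unit (r : R) : r < 1 -> (disc r `<=` unit_disc)%classic.
Proof. by move=> r1 z zr; rewrite unit_discE (le_lt_trans zr). Qed.

(** The bound on [r] puts the disc inside the square [-1, 1] x [-1, 1]; compactness is carried by
    [to_complex] from a closed part of this square. *)
Lemma compact_disc (r : R) : r <= 1 -> compact (disc r).
Proof.
move=> r1.
pose Q := ((`[-1, 1] `*` `[-1, 1])%classic : set (R * R)).
pose D := [set p : R * R | sqnorm (to_complex p) <= r]%classic.
have -> : disc r = (@to_complex R @` (Q `&` D))%classic.
  apply/seteqP; split=> [[x y] xyr|_ [p [_ pr] <-]//].
  exists (x, y) => //; split=> //; rewrite /Q /=; move: xyr.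
  rewrite /disc/sqnorm /= => xyr; rewrite !in_itv /=.
  by split; apply/andP; split; nra.
apply: continuous_compact.
  by apply: continuous_subspaceT; exact: continuous_to_complex.
apply: compact_closedI; first by apply: compact_setX; exact: segment_compact.
have := @preimage_closed _ R (sqnorm \o @to_complex R) [set x : R | x <= r]%classic.
apply; last exact: closed_le.
move=> p _; apply: (@continuous_comp _ (R[i]^o) _ (@to_complex R)).
  exact: continuous_to_complex.
exact: continuous_sqnorm.
Qed.

End ComplexTopology.

(** * Wirtinger derivatives *)

Section RealDerivatives.
Variable R : realType.
Implicit Types (f g : R[i] -> R[i]) (z v d : R[i]).
Local Open Scope classical_set_scope.
Local Open Scope ring_scope.
Local Open Scope complex_scope.

Lemma complexP z w : complex.Re z = complex.Re w -> complex.Im z = complex.Im w -> z = w.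
Proof. by case: z w => [? ?] [? ?] /= -> ->. Qed.

Lemma conjE z : Num.conj z = z^*.
Proof. by []. Qed.

(** A relation that bundles existence and value of the derivative: the rules below differentiate a
    compound expression in one pass and yield both [rderivable] and [rderive]. *)
Definition rd f v z d :=
  is_derive (0 : R) 1 (@complex.Re R \o along f z v) (complex.Re d) /\
  is_derive (0 : R) 1 (@complex.Im R \o along f z v) (complex.Im d).

Lemma rd_rderivable f v z d : rd f v z d -> rderivable f v z.
Proof. by case=> fr fi; split; exact: ex_derive. Qed.

Lemma rd_rderive f v z d : rd f v z d -> rderive v f z = d.
Proof.
by case=> fr fi; apply: complexP; rewrite /rderive /= derive1E derive_val.
Qed.

Lemma along0 f z v : along f z v 0 = f z.
Proof. by rewrite /along mul0r addr0. Qed.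

Lemma rd_eq f v z d d' : rd f v z d -> d = d' -> rd f v z d'.
Proof. by move=> + <-. Qed.

Lemma rd_cst c v z : rd (fun=> c) v z 0.
Proof. by split; exact: is_derive_cst. Qed.

Lemma is_derive_affine (a b x : R) : is_derive x 1 (fun t : R => a + t * b) b.
Proof.
have h := @is_deriveD R R R (cst a) (id * cst b) x 1 _ _ (is_derive_cst a x 1)
  (@is_deriveM R R id (cst b) x 1 _ _ (is_derive_id x 1) (is_derive_cst b x 1)).
apply: (@is_derive_eq R R R _ _ _ _ _ h).
by rewrite /= scaler0 !add0r [_ *: _]mulr1.
Qed.

Lemma rd_id v z : rd id v z v.
Proof.
by split; [rewrite [X in is_derive _ _ X _](_ : _ = fun t : R => complex.Re z + t * complex.Re v)|
  rewrite [X in is_derive _ _ X _](_ : _ = fun t : R => complex.Im z + t * complex.Im v)];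
  try exact: is_derive_affine; apply/funext => t; rewrite /along /=;
  case: z v => [? ?] [? ?] /=; ring.
Qed.

Lemma rd_conj v z : rd conjc v z v^*.
Proof.
have [hr hi] := rd_id v z.
split.
  rewrite [X in is_derive _ _ X _](_ : _ = @complex.Re R \o along id z v).
    by case: v {hi} hr.
  by apply/funext => t; rewrite /along /=; case: (z + _).
rewrite [X in is_derive _ _ X _](_ : _ = - (@complex.Im R \o along id z v)).
  by apply: (is_derive_eq (is_deriveN hi)); case: (v).
apply/funext => t; transitivity (- complex.Im (z + t%:C * v)); last by [].
by rewrite /= /along; case: (z + _).
Qed.

Lemma rd_add f g v z d e : rd f v z d -> rd g v z e ->
  rd (fun z => f z + g z) v z (d + e).
Proof.
move=> [fr fi] [gr gi]; split.
  rewrite [X in is_derive _ _ X _](_ : _ =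
    (@complex.Re R \o along f z v) + (@complex.Re R \o along g z v)).
    by rewrite raddfD; exact: is_deriveD.
  by apply/funext => t; rewrite /= raddfD.
rewrite [X in is_derive _ _ X _](_ : _ =
  (@complex.Im R \o along f z v) + (@complex.Im R \o along g z v)).
  by rewrite raddfD; exact: is_deriveD.
by apply/funext => t; rewrite /= raddfD.
Qed.

Lemma ReM z w : complex.Re (z * w) =
  complex.Re z * complex.Re w - complex.Im z * complex.Im w.
Proof. by case: z w => [? ?] [? ?]. Qed.

Lemma ImM z w : complex.Im (z * w) =
  complex.Re z * complex.Im w + complex.Im z * complex.Re w.
Proof. by case: z w => [? ?] [? ?]. Qed.

Lemma rd_mul f g v z d e : rd f v z d -> rd g v z e ->
  rd (fun z => f z * g z) v z (d * g z + f z * e).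
Proof.
move=> [fr fi] [gr gi]; split.
  rewrite [X in is_derive _ _ X _](_ : _ =
    (@complex.Re R \o along f z v) * (@complex.Re R \o along g z v) -
    (@complex.Im R \o along f z v) * (@complex.Im R \o along g z v)).
    apply: (@is_derive_eq R R R _ _ _ _ _ (@is_deriveB R R R _ _ _ _ _ _
      (@is_deriveM R R _ _ _ _ _ _ fr gr) (@is_deriveM R R _ _ _ _ _ _ fi gi))).
    rewrite /= !along0 [complex.Re (_ + _)]raddfD /= !ReM -![_ *: _]/(_ * _); ring.
  by apply/funext => t; rewrite /= ReM.
rewrite [X in is_derive _ _ X _](_ : _ =
  (@complex.Re R \o along f z v) * (@complex.Im R \o along g z v) +
  (@complex.Im R \o along f z v) * (@complex.Re R \o along g z v)).
  apply: (@is_derive_eq R R R _ _ _ _ _ (@is_deriveD R R R _ _ _ _ _ _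
    (@is_deriveM R R _ _ _ _ _ _ fr gi) (@is_deriveM R R _ _ _ _ _ _ fi gr))).
  rewrite /= !along0 [complex.Im (_ + _)]raddfD /= !ImM -![_ *: _]/(_ * _); ring.
by apply/funext => t; rewrite /= ImM.
Qed.

Lemma rd_radial (u : R -> R) v z (d : R) : is_derive (sqnorm z) 1 u d ->
  rd (fun z => (u (sqnorm z))%:C) v z (d%:C * (z^* * v + z * v^*)).
Proof.
move=> ud; split; last first.
  rewrite (_ : complex.Im _ = 0); first exact: is_derive_cst.
  by case: z v {ud} => [? ?] [? ?] /=; ring.
(* [s] is |z + t v|^2 expanded as a polynomial in t; its linear coefficient is the directional
   derivative of |z|^2. *)
pose s (t : R) : R := sqnorm z + t * (complex.Re (z^* * v + z * v^*) + t * sqnorm v).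
rewrite [X in is_derive _ _ X _](_ : _ = u \o s); last first.
  apply/funext => t; rewrite /along /s /sqnorm /=; congr u.
  by case: z v {ud s} => [? ?] [? ?] /=; ring.
have ds : is_derive (0 : R) 1 s (complex.Re (z^* * v + z * v^*)).
  have da := is_derive_affine (complex.Re (z^* * v + z * v^*)) (sqnorm v) 0.
  have h := @is_deriveD R R R (cst (sqnorm z)) _ 0 1 _ _ (is_derive_cst _ _ _)
    (@is_deriveM R R id _ 0 1 _ _ (is_derive_id _ _) da).
  apply: (@is_derive_eq R R R _ _ _ _ _ h).
  by rewrite /= !mul0r addr0 scale0r !add0r [_ *: _]mulr1.
have u0 : is_derive (s 0) 1 u d by rewrite /s mul0r addr0.
by apply: is_derive_eq; rewrite [in RHS]ReM /= mul0r subr0.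
Qed.

Lemma cvg_segment z v : ((z + t%:C * v : R[i]^o) @[t --> (0 : R)]) --> (z : R[i]^o).
Proof.
have [hr hi] := rd_id v z.
apply: cvg_complex; rewrite -[in X in _ --> X](along0 id z v).
  exact/differentiable_continuous/derivable1_diffP/(@ex_derive _ _ _ _ _ _ _ hr).
exact/differentiable_continuous/derivable1_diffP/(@ex_derive _ _ _ _ _ _ _ hi).
Qed.

Lemma near_rd f g v z d : (\forall w \near (z : R[i]^o), f w = g w) ->
  rd f v z d -> rd g v z d.
Proof.
move=> /(@cvg_segment z v) fg [fr fi].
have {}fg : \forall t \near (0 : R), along f z v t = along g z v t by [].
split.
  apply: (@near_eq_is_derive _ _ _ _ _ _ _ _ _ fr).
  by near=> t; rewrite /=; congr complex.Re; near: t.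
apply: (@near_eq_is_derive _ _ _ _ _ _ _ _ _ fi).
by near=> t; rewrite /=; congr complex.Im; near: t.
Unshelve. all: by end_near. Qed.

(* [p] and [q] are the Wirtinger derivatives of [f] at [z]. *)
Definition wd f z p q := forall v, rd f v z (p * v + q * v^*).

Lemma wd_dz f z p q : wd f z p q -> wirtinger_dz f z = p.
Proof.
move=> fpq; rewrite /wirtinger_dz !(rd_rderive (fpq _)) rmorph1.
apply: (mulIf (_ : 2 != 0)); rewrite ?pnatr_eq0// divfK ?pnatr_eq0//.
by apply: complexP; case: p q {fpq} => [? ?] [? ?] /=; ring.
Qed.

Lemma wd_dzbar f z p q : wd f z p q -> wirtinger_dzbar f z = q.
Proof.
move=> fpq; rewrite /wirtinger_dzbar !(rd_rderive (fpq _)) rmorph1.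
apply: (mulIf (_ : 2 != 0)); rewrite ?pnatr_eq0// divfK ?pnatr_eq0//.
by apply: complexP; case: p q {fpq} => [? ?] [? ?] /=; ring.
Qed.

Lemma wd_eq f z p q p' q' : wd f z p q -> p = p' -> q = q' -> wd f z p' q'.
Proof. by move=> + <- <-. Qed.

Lemma wd_cst c z : wd (fun=> c) z 0 0.
Proof. by move=> v; rewrite !mul0r addr0; exact: rd_cst. Qed.

Lemma wd_id z : wd id z 1 0.
Proof. by move=> v; rewrite mul1r mul0r addr0; exact: rd_id. Qed.

Lemma wd_conj z : wd conjc z 0 1.
Proof. by move=> v; rewrite mul1r mul0r add0r; exact: rd_conj. Qed.

Lemma wd_add f g z p q p' q' : wd f z p q -> wd g z p' q' ->
  wd (fun z => f z + g z) z (p + p') (q + q').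
Proof.
by move=> fd gd v; apply: (rd_eq (rd_add (fd v) (gd v))); ring.
Qed.

Lemma wd_mul f g z p q p' q' : wd f z p q -> wd g z p' q' ->
  wd (fun z => f z * g z) z (p * g z + f z * p') (q * g z + f z * q').
Proof.
by move=> fd gd v; apply: (rd_eq (rd_mul (fd v) (gd v))); ring.
Qed.

Lemma wd_radial (u : R -> R) z (d : R) : is_derive (sqnorm z) 1 u d ->
  wd (fun z => (u (sqnorm z))%:C) z (d%:C * z^*) (d%:C * z).
Proof.
by move=> ud v; apply: (rd_eq (rd_radial v ud)); ring.
Qed.

(** The metric of the theorem is prescribed on the disc only, so its derivatives there come by
    locality from those of the explicit matrix. *)
Lemma near_wd f g z p q : (\forall w \near (z : R[i]^o), f w = g w) ->
  wd f z p q -> wd g z p q.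
Proof. by move=> fg fd v; exact: near_rd fg (fd v). Qed.

End RealDerivatives.

(** * Goursat's theorem *)

Section Goursat.
Variable R : realType.
Local Open Scope classical_set_scope.
Local Open Scope ring_scope.
Local Open Scope complex_scope.
Local Notation mu := (@lebesgue_measure R).
Implicit Types (f : R -> R) (a b c e : R).

Lemma integrable_segment f a b :
  (forall t, a <= t <= b -> {for t, continuous f}) ->
  mu.-integrable `[a, b] (EFin \o f).
Proof.
move=> cf; apply: continuous_compact_integrable; first exact: segment_compact.
by apply: continuous_in_subspaceT => t; rewrite inE /= in_itv /=; exact: cf.
Qed.

Lemma Rintegral_split f a b c : a <= c <= b ->
  (forall t, a <= t <= b -> {for t, continuous f}) ->
  \int[mu]_(t in `[a, b]) f t =
  \int[mu]_(t in `[a, c]) f t + \int[mu]_(t in `[c, b]) f t.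
Proof.
move=> /andP[ac cb] cf; have fi := integrable_segment cf.
have -> : \int[mu]_(t in `[c, b]) f t = \int[mu]_(t in `]c, b]) f t.
  rewrite Rintegral_itv_obnd_cbnd//; apply: integrableS fi => //.
  by apply: subset_itvr; rewrite bnd_simp.
have /eqP := @Rintegral_itvB _ f (BLeft a) (BRight b) c fi ac cb.
by rewrite subr_eq addrC => /eqP.
Qed.

Lemma Rintegral_cst_itv a b c : a <= b -> \int[mu]_(t in `[a, b]) c = c * (b - a).
Proof.
move=> ab; rewrite Rintegral_cst//= lebesgue_measure_itv/= lte_fin.
case: ltP => //= ba.
by rewrite (_ : b = a) ?subrr//; apply/eqP; rewrite eq_le ab ba.
Qed.

Lemma Rintegral_approx f a b c e : a <= b ->
  (forall t, a <= t <= b -> {for t, continuous f}) ->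
  (forall t, a <= t <= b -> `|f t - c| <= e) ->
  `|\int[mu]_(t in `[a, b]) f t - c * (b - a)| <= e * (b - a).
Proof.
move=> ab cf fe; have fi := integrable_segment cf.
have ki k : mu.-integrable `[a, b] (EFin \o (fun=> k)).
  by apply: integrable_segment => t _; exact: cst_continuous.
rewrite -Rintegral_cst_itv// -RintegralB//.
have fci : mu.-integrable `[a, b] (EFin \o (fun t => f t - c)).
  by rewrite (_ : _ \o _ = (EFin \o f) \- (EFin \o (fun=> c)))%E//; exact: integrableB.
apply: le_trans (le_normr_Rintegral _ fci) _ => //.
rewrite -Rintegral_cst_itv//; apply: le_Rintegral => //.
exact: (integrable_abse fci).
Qed.

Lemma nested_intervals (a l : nat -> R) :
  (forall n, a n <= a n.+1) -> (forall n, a n.+1 + l n.+1 <= a n + l n) ->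
  (forall n, 0 <= l n) -> exists p, forall n, a n <= p <= a n + l n.
Proof.
move=> ha hl l0.
have am m n : (m <= n)%N -> a m <= a n.
  by move=> mn; apply: (@homo_leq _ a (fun x y => x <= y)) => // ? ? ?; exact: le_trans.
have lm m n : (m <= n)%N -> a n + l n <= a m + l m.
  move=> mn; apply: (@homo_leq _ (fun n => a n + l n) (fun x y => y <= x)) => //.
  by move=> x y z /= yx /le_trans; exact.
have al m n : a m <= a n + l n.
  case: (leqP m n) => mn; first by rewrite (le_trans (am _ _ mn))// lerDl.
  by rewrite (le_trans _ (lm _ _ (ltnW mn)))// lerDl.
exists (sup (range a)) => n; apply/andP; split.
  apply: sup_upper_bound; last by exists n.
  split; first by exists (a 0), 0.
  by exists (a 0 + l 0) => _ [m _ <-]; exact: al.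
by apply: ge_sup; [exists (a 0), 0|move=> _ [m _ <-]; exact: al].
Qed.

Implicit Types (g : R[i]^o -> R[i]^o) (x y L M : R).

(** On a vertical side dz = i dt and on a horizontal side dz = dt, so the imaginary part of g dz is
    Re g dt on the former and Im g dt on the latter. This part is all that the mean value of a real
    part requires. *)
Definition vint g x y M := \int[mu]_(t in `[y, y + M]) complex.Re (g (x +i* t)).
Definition hint g x y L := \int[mu]_(t in `[x, x + L]) complex.Im (g (t +i* y)).

(* Imaginary part of the integral of [g dz] along the boundary of the rectangle
   with lower left corner (x, y), width L and height M. *)
Definition boundary g x y L M :=
  vint g (x + L) y M - vint g x y M - (hint g x (y + M) L - hint g x y L).

Definition rect x y L M : set R[i]^o :=
  [set w | x <= complex.Re w <= x + L /\ y <= complex.Im w <= y + M].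

Lemma continuous_vert g x t : {for (x +i* t : R[i]^o), continuous g} ->
  {for t, continuous (fun t => complex.Re (g (x +i* t)))}.
Proof.
move=> cg.
have h : (x +i* u : R[i]^o) @[u --> t] --> (x +i* t : R[i]^o).
  by apply: cvg_complex; [exact: cvg_cst|exact: cvg_id].
have h2 := cvg_comp (fun u => (x +i* u : R[i]^o)) g h cg.
exact: (cvg_comp (fun u => g (x +i* u : R[i]^o)) (@complex.Re R : R[i]^o -> R)
  h2 (@continuous_Re R _)).
Qed.

Lemma continuous_horiz g y t : {for (t +i* y : R[i]^o), continuous g} ->
  {for t, continuous (fun t => complex.Im (g (t +i* y)))}.
Proof.
move=> cg.
have h : (u +i* y : R[i]^o) @[u --> t] --> (t +i* y : R[i]^o).
  by apply: cvg_complex; [exact: cvg_id|exact: cvg_cst].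
have h2 := cvg_comp (fun u => (u +i* y : R[i]^o)) g h cg.
exact: (cvg_comp (fun u => g (u +i* y : R[i]^o)) (@complex.Im R : R[i]^o -> R)
  h2 (@continuous_Im R _)).
Qed.

(** Each inner segment is a side of two neighbouring quarters, which run along it in opposite
    directions. *)
Lemma boundary_split4 g x y L M : 0 <= L -> 0 <= M ->
  (forall w, rect x y (L + L) (M + M) w -> {for w, continuous g}) ->
  boundary g x y (L + L) (M + M) =
  boundary g x y L M + boundary g (x + L) y L M +
  (boundary g x (y + M) L M + boundary g (x + L) (y + M) L M).
Proof.
move=> L0 M0 cg.
have vE x' : x <= x' <= x + (L + L) ->
    vint g x' y (M + M) = vint g x' y M + vint g x' (y + M) M.
  move=> xx'; rewrite /vint addrA; apply: Rintegral_split; first by apply/andP; split; lra.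
  by move=> t yt; apply: continuous_vert; apply: cg; split => //=; rewrite -addrA in yt *; lra.
have hE y' : y <= y' <= y + (M + M) ->
    hint g x y' (L + L) = hint g x y' L + hint g (x + L) y' L.
  move=> yy'; rewrite /hint addrA; apply: Rintegral_split; first by apply/andP; split; lra.
  by move=> t xt; apply: continuous_horiz; apply: cg; split => //=; lra.
rewrite /boundary (vE x); last by apply/andP; split; lra.
rewrite (vE (x + (L + L))); last by apply/andP; split; lra.
rewrite (hE y); last by apply/andP; split; lra.
rewrite (hE (y + (M + M))); last by apply/andP; split; lra.
by rewrite !addrA; ring.
Qed.

(** The affine part of [g] at [w0] contributes c L M, with c = Re d, to the vertical difference and
    to the horizontal one, and these cancel. The remainder is at most e (L + M) at each point,
    because points of the rectangle are at distance at most L + M, and the perimeter is 2 (L + M);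
    the constant 4 leaves some room. *)
Lemma boundary_approx g x y L M (d : R[i]) w0 e : 0 <= L -> 0 <= M ->
  (forall w, rect x y L M w -> {for w, continuous g}) ->
  rect x y L M w0 ->
  (forall w, rect x y L M w ->
    complex.Re `|g w - g w0 - d * (w - w0)| <= e * complex.Re `|w - w0|) ->
  0 <= e -> `|boundary g x y L M| <= 4 * e * (L + M) ^+ 2.
Proof.
move=> L0 M0 cg [/= xw0 yw0] ge e0.
pose c := complex.Re d.
have dist w : rect x y L M w -> complex.Re `|w - w0| <= L + M.
  move=> [/= xw yw]; apply: le_trans (norm_le_ReIm _) _; rewrite !raddfB /=.
  by apply: lerD; rewrite ler_norml; lra.
have ReE w : complex.Re (g w - g w0 - d * (w - w0)) =
  complex.Re (g w) - complex.Re (g w0) -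
  (c * (complex.Re w - complex.Re w0) - complex.Im d * (complex.Im w - complex.Im w0)).
  rewrite /c; move: (g w) (g w0) => [? ?] [? ?]; case: (d) (w) (w0) => [? ?] [? ?] [? ?] /=; ring.
have ImE w : complex.Im (g w - g w0 - d * (w - w0)) =
  complex.Im (g w) - complex.Im (g w0) -
  (c * (complex.Im w - complex.Im w0) + complex.Im d * (complex.Re w - complex.Re w0)).
  rewrite /c; move: (g w) (g w0) => [? ?] [? ?]; case: (d) (w) (w0) => [? ?] [? ?] [? ?] /=; ring.
have E w : rect x y L M w -> `|complex.Re (g w - g w0 - d * (w - w0))| <= e * (L + M).
  move=> rw; apply: le_trans (normRe_le _) _; apply: le_trans (ge _ rw) _.
  by rewrite ler_wpM2l// dist.
have E' w : rect x y L M w -> `|complex.Im (g w - g w0 - d * (w - w0))| <= e * (L + M).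
  move=> rw; apply: le_trans (normIm_le _) _; apply: le_trans (ge _ rw) _.
  by rewrite ler_wpM2l// dist.
have iv x' : x <= x' <= x + L ->
    mu.-integrable `[y, y + M] (EFin \o (fun t => complex.Re (g (x' +i* t)))).
  move=> xx'; apply: integrable_segment => t yt.
  by apply: continuous_vert; apply: cg.
have ih y' : y <= y' <= y + M ->
    mu.-integrable `[x, x + L] (EFin \o (fun t => complex.Im (g (t +i* y')))).
  move=> xx'; apply: integrable_segment => t yt.
  by apply: continuous_horiz; apply: cg.
have V : `|vint g (x + L) y M - vint g x y M - c * L * M| <= 2 * (e * (L + M)) * M.
  rewrite /vint -RintegralB//; last 2 first.
  - by apply: iv; lra.
  - by apply: iv; lra.
  have := @Rintegral_approx (fun t => complex.Re (g ((x + L) +i* t)) - complex.Re (g (x +i* t)))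
    y (y + M) (c * L) (2 * (e * (L + M))).
  rewrite (addrC y M) addrK; apply; first by lra.
    move=> t yt; apply: continuousB; apply: continuous_vert; apply: cg; split => /=; lra.
  move=> t yt.
  have /E : rect x y L M ((x + L) +i* t) by split => /=; lra.
  have /E : rect x y L M (x +i* t) by split => /=; lra.
  rewrite !ReE /= !ler_norml => h1 h2; lra.
have H : `|hint g x (y + M) L - hint g x y L - c * L * M| <= 2 * (e * (L + M)) * L.
  rewrite /hint -RintegralB//; last 2 first.
  - by apply: ih; lra.
  - by apply: ih; lra.
  have := @Rintegral_approx (fun t => complex.Im (g (t +i* (y + M))) - complex.Im (g (t +i* y)))
    x (x + L) (c * M) (2 * (e * (L + M))).
  rewrite (addrC x L) addrK (mulrAC _ M); apply; first by lra.
    move=> t yt; apply: continuousB; apply: continuous_horiz; apply: cg; split => /=; lra.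
  move=> t yt.
  have /E' : rect x y L M (t +i* (y + M)) by split => /=; lra.
  have /E' : rect x y L M (t +i* y) by split => /=; lra.
  rewrite !ImE /= !ler_norml => h1 h2; lra.
rewrite /boundary; apply: le_trans (_ : 2 * (e * (L + M)) * M + 2 * (e * (L + M)) * L <= _).
  move: V H; rewrite !ler_norml; lra.
rewrite -mulrDr (addrC M) expr2 !mulrA ler_wpM2r ?addr_ge0//.
rewrite ler_wpM2r ?addr_ge0// ler_wpM2r//; lra.
Qed.

Lemma derivable_approx g w0 : derivable g w0 1 ->
  exists d : R[i], forall e : R, 0 < e -> exists2 r : R, 0 < r &
    forall w, complex.Re `|w - w0| < r ->
      complex.Re `|g w - g w0 - d * (w - w0)| <= e * complex.Re `|w - w0|.
Proof.
move=> /cvg_ex[/= d /cvgrPdist_lt gd]; exists d => e e0.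
have : (0 : R[i]) < e%:C by rewrite ltcR.
move=> /gd /nbhs_normP[r' /gt0_complexE[r r0 ->{r'}]] gr; exists r => [//|w wr].
have [->|ww0] := eqVneq w w0.
  rewrite !subrr mulr0 subr0.
  change (complex.Re `|0 : R[i]| <= e * complex.Re `|0 : R[i]|).
  by rewrite normr0 mulr0.
have w0n : w - w0 != 0 by rewrite subr_eq0.
have := gr (w - w0); rewrite /ball_ [X in X -> _]/= sub0r normrN ltC_norm => /(_ wr w0n).
rewrite [_ *: 1]mulr1 subrK -[_ *: _]/(_ * _) => dw.
rewrite -lecR rmorphM /= -!normC_Re.
have -> : g w - g w0 - d * (w - w0) = - (d - (w - w0)^-1 * (g w - g w0)) * (w - w0).
  by field.
by rewrite normrM normrN ler_wpM2r// ltW.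
Qed.

Lemma derivable_continuous g w0 : derivable g w0 1 -> {for w0, continuous g}.
Proof. by move=> /derivable1_diffP /differentiable_continuous. Qed.

Lemma rect_sub x y L M x' y' L' M' : x <= x' -> x' + L' <= x + L -> y <= y' ->
  y' + M' <= y + M -> rect x' y' L' M' `<=` rect x y L M.
Proof. by move=> ? ? ? ? w [/= ? ?]; split => /=; lra. Qed.

(** If every quarter carried less than a fourth of the total in absolute value, the triangle
    inequality would fail. *)
Lemma exists_quadrant g x y L M : 0 <= L -> 0 <= M ->
  (forall w, rect x y (L + L) (M + M) w -> {for w, continuous g}) ->
  exists q : R * R, [/\ x <= q.1 <= x + L, y <= q.2 <= y + M &
    `|boundary g x y (L + L) (M + M)| <= 4 * `|boundary g q.1 q.2 L M|].
Proof.
move=> L0 M0 cg.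
have := boundary_split4 L0 M0 cg.
set b := boundary g x y (L + L) (M + M); set b1 := boundary g x y L M.
set b2 := boundary g (x + L) y L M; set b3 := boundary g x (y + M) L M.
set b4 := boundary g (x + L) (y + M) L M => bE.
have [|h1] := leP `|b| (4 * `|b1|); first by exists (x, y); split => //=; lra.
have [|h2] := leP `|b| (4 * `|b2|); first by exists (x + L, y); split => //=; lra.
have [|h3] := leP `|b| (4 * `|b3|); first by exists (x, y + M); split => //=; lra.
have [|h4] := leP `|b| (4 * `|b4|); first by exists (x + L, y + M); split => //=; lra.
have := ler_normD (b1 + b2) (b3 + b4); rewrite -bE => B.
have := ler_normD b1 b2; have := ler_normD b3 b4; lra.
Qed.

(** Each bisection loses at most a factor 4, while [boundary_approx] at the common point of the
    nested rectangles is quadratic in their size and so gains the same factor back. Only the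
    arbitrarily small e survives. *)
Theorem goursat g x y L M : 0 <= L -> 0 <= M ->
  (forall w, rect x y L M w -> derivable g w 1) -> boundary g x y L M = 0.
Proof.
move=> L0 M0 dg.
have cg w : rect x y L M w -> {for w, continuous g}.
  by move=> /dg; exact: derivable_continuous.
pose l n := L / 2 ^+ n; pose m n := M / 2 ^+ n.
have l0 n : 0 <= l n by rewrite divr_ge0// exprn_ge0.
have m0 n : 0 <= m n by rewrite divr_ge0// exprn_ge0.
have lS n : l n = l n.+1 + l n.+1.
  by rewrite /l exprS; field; rewrite expf_neq0.
have mS n : m n = m n.+1 + m n.+1.
  by rewrite /m exprS; field; rewrite expf_neq0.
pose quadrant n (p q : R * R) := [/\ p.1 <= q.1 <= p.1 + l n.+1,
  p.2 <= q.2 <= p.2 + m n.+1 &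
  `|boundary g p.1 p.2 (l n) (m n)| <= 4 * `|boundary g q.1 q.2 (l n.+1) (m n.+1)|].
(* The default [p] of [xget] is never taken along the sequence: a good quarter exists as long as the
   current rectangle lies in the original one, and this inclusion is proved by induction from the
   choices already made. *)
pose next n p := xget p (quadrant n p).
pose c := fix c n := if n is n'.+1 then next n' (c n') else (x, y).
have csub n : rect (c n).1 (c n).2 (l n) (m n) `<=` rect x y L M /\ quadrant n (c n) (c n.+1).
  have Q k : rect (c k).1 (c k).2 (l k) (m k) `<=` rect x y L M -> quadrant k (c k) (c k.+1).
    move=> sub; have [q qq] : exists q, quadrant k (c k) q.
      rewrite /quadrant (lS k) (mS k).
      apply: (@exists_quadrant g (c k).1 (c k).2 (l k.+1) (m k.+1) (l0 _) (m0 _)).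
      by move=> w; rewrite -lS -mS => /sub /cg.
    exact: (xgetPex _ (ex_intro _ q qq)).
  suff S k : rect (c k).1 (c k).2 (l k) (m k) `<=` rect x y L M by split; [|apply: Q].
  elim: k => [|k IH]; first by rewrite /l /m !expr0 !divr1.
  have [h1 h2 _] := Q _ IH; apply: subset_trans IH.
  by rewrite (lS k) (mS k); apply: rect_sub; lra.
have [p hp] : exists p, forall n, (c n).1 <= p <= (c n).1 + l n.
  by apply: nested_intervals => // n; have [_ [? ? _]] := csub n; rewrite ?(lS n); lra.
have [q hq] : exists q, forall n, (c n).2 <= q <= (c n).2 + m n.
  by apply: nested_intervals => // n; have [_ [? ? _]] := csub n; rewrite ?(mS n); lra.
pose w0 : R[i]^o := p +i* q.
have w0r n : rect (c n).1 (c n).2 (l n) (m n) w0 by split => /=.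
have bn n : `|boundary g x y L M| <= 4 ^+ n * `|boundary g (c n).1 (c n).2 (l n) (m n)|.
  elim: n => [|n IH]; first by rewrite /l /m !expr0 !divr1 mul1r.
  apply: le_trans IH _; have [_ [_ _ h]] := csub n.
  by rewrite exprSr -mulrA ler_wpM2l// exprn_ge0.
have [d dE] := derivable_approx (dg _ ((csub 0%N).1 _ (w0r 0%N))).
have small e : 0 < e -> `|boundary g x y L M| <= 4 * e * (L + M) ^+ 2.
  move=> e0; have [r r0 er] := dE e e0.
  have [n nr] : exists n, l n + m n < r.
    have := @cvg_geometric R (L + M) 2^-1.
    rewrite ger0_norm ?invr_ge0// invf_lt1// ltr1n => /(_ isT)/cvgrPdist_lt/(_ _ r0).
    move=> [n _ /(_ n)]; rewrite /= leqnn sub0r normrN => /(_ isT) h.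
    exists n; apply: le_lt_trans h; rewrite /l /m -mulrDl exprVn; exact: ler_norm.
  apply: le_trans (bn n) _.
  have -> : 4 * e * (L + M) ^+ 2 = 4 ^+ n * (4 * e * (l n + m n) ^+ 2).
    rewrite /l /m -mulrDl expr_div_n -exprM mulnC exprM (_ : 2 ^+ 2 = 4 :> R); last by ring.
    by field; rewrite expf_neq0.
  rewrite ler_wpM2l ?exprn_ge0//.
  have h w : rect (c n).1 (c n).2 (l n) (m n) w -> complex.Re `|w - w0| < r.
    move=> [/= h1 h2]; have [/= h3 h4] := w0r n.
    apply: le_lt_trans (norm_le_ReIm _) _; apply: le_lt_trans nr.
    by rewrite !raddfB /= lerD// ler_norml; lra.
  apply: (boundary_approx (d := d) (w0 := w0)) => //.
  - by move=> w /(csub n).1 /cg.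
  - by move=> w /h; exact: er.
  - exact: ltW.
apply/eqP; rewrite -normr_eq0 eq_le normr_ge0 andbT; apply/ler_addgt0Pr => e e0.
(* The added 1 keeps the denominator positive when the rectangle is reduced to a point. *)
rewrite add0r; have := small (e / (4 * ((L + M) ^+ 2 + 1))).
have LM : 0 < (L + M) ^+ 2 + 1 by rewrite ltr_wpDl// sqr_ge0.
rewrite divr_gt0 ?mulr_gt0// => /(_ isT)/le_trans; apply.
set K := (L + M) ^+ 2 in LM *.
have -> : 4 * (e / (4 * (K + 1))) * K = e * (K / (K + 1)) by field; rewrite gt_eqF.
by rewrite ger_pMr// ler_pdivrMr// mul1r lerDl.
Qed.

End Goursat.

(** * Complex exponential and mean value property *)

Section MeanValue.
Variable R : realType.
Local Open Scope classical_set_scope.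
Local Open Scope ring_scope.
Local Open Scope complex_scope.
Local Notation mu := (@lebesgue_measure R).
Implicit Types (phi : R[i]^o -> R[i]^o).

Definition cexp (w : R[i]^o) : R[i]^o := (expR (complex.Re w))%:C * expi (complex.Im w).

Lemma cexpD v w : cexp (v + w) = cexp v * cexp w.
Proof.
rewrite /cexp !raddfD /= expRD /expi cosD sinD.
by apply: complexP => /=; ring.
Qed.

Lemma is_derive_approx (f : R -> R) (d : R) : is_derive (0 : R) 1 f d ->
  forall e : R, 0 < e -> \forall t \near (0 : R), `|f t - f 0 - d * t| <= e * `|t|.
Proof.
move=> [/cvg_ex[/= l fl] <-] e e0; rewrite /derive (cvg_lim _ fl)//.
move: fl => /cvgrPdist_lt /(_ _ e0) /nbhs_normP[r /= r0 fr].
apply/nbhs_normP; exists r => //= t tr.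
have [->|t0] := eqVneq t 0; first by rewrite subrr mulr0 subr0 normr0 mulr0.
have := fr t tr t0; rewrite [_ *: 1]mulr1 addr0 => /ltW h.
have -> : f t - f 0 - l * t = - (l - t^-1 *: (f t - f 0)) * t.
  by rewrite -[_ *: _]/(_ * _); field.
by rewrite normrM normrN ler_wpM2r.
Qed.

Lemma cexp_approx (e : R) : 0 < e -> exists2 r : R, 0 < r &
  forall h, complex.Re `|h| < r -> complex.Re `|cexp h - 1 - h| <= e * complex.Re `|h|.
Proof.
(* With h = u + i v, the real and imaginary parts of exp h - 1 - h split into four terms, each small
   compared with |h|. Two of them carry the factor exp u, bounded by 2 near 0, so the count is 1 + 2
   + 2 + 1 = 6. *)
move=> e0; have e6 : 0 < e / 6 by rewrite divr_gt0.
have H1 := is_derive_approx (is_derive_expR 0) e6.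
have H2 := is_derive_approx (is_derive_cos 0) e6.
have H3 := is_derive_approx (is_derive_sin 0) e6.
have H4 : \forall t \near (0 : R), `|expR 0 - expR t| < Num.min (e / 6) 1.
  have := @continuous_expR R 0 => /cvgrPdist_lt; apply.
  by rewrite lt_min e6 ltr01.
have /nbhs_normP[r r0 hr] : \forall t \near (0 : R),
  [/\ `|expR t - 1 - t| <= e / 6 * `|t|, `|cos t - 1| <= e / 6 * `|t|,
      `|sin t - t| <= e / 6 * `|t|, `|expR t - 1| <= e / 6 & expR t <= 2].
  near=> t; split.
  - have : `|expR t - expR 0 - expR 0 * t| <= e / 6 * `|t| by near: t.
    by rewrite expR0 mul1r.
  - have : `|cos t - cos 0 - (- sin 0) * t| <= e / 6 * `|t| by near: t.
    by rewrite cos0 sin0 oppr0 mul0r subr0.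
  - have : `|sin t - sin 0 - cos 0 * t| <= e / 6 * `|t| by near: t.
    by rewrite cos0 sin0 mul1r subr0.
  - have : `|expR 0 - expR t| < Num.min (e / 6) 1 by near: t.
    by rewrite expR0 lt_min distrC => /andP[/ltW].
  - have : `|expR 0 - expR t| < Num.min (e / 6) 1 by near: t.
    rewrite expR0 lt_min distrC => /andP[_]; rewrite ltr_norml; lra.
exists r => // h hr'; pose u := complex.Re h; pose v := complex.Im h.
have ul : `|u| <= complex.Re `|h| by exact: normRe_le.
have vl : `|v| <= complex.Re `|h| by exact: normIm_le.
have [|u1 _ _ u4 u5] := hr u; first by rewrite /ball_ /= sub0r normrN (le_lt_trans ul).
have [|_ v2 v3 _ _] := hr v; first by rewrite /ball_ /= sub0r normrN (le_lt_trans vl).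
have eu : 0 < expR u by exact: expR_gt0.
have eR : complex.Re (cexp h - 1 - h) = (expR u - 1 - u) + expR u * (cos v - 1).
  by rewrite /cexp /expi /u /v; case: (h) => a b /=; ring.
have eI : complex.Im (cexp h - 1 - h) = expR u * (sin v - v) + (expR u - 1) * v.
  by rewrite /cexp /expi /u /v; case: (h) => a b /=; ring.
apply: le_trans (norm_le_ReIm _) _; rewrite eR eI.
set N := complex.Re _ in ul vl *.
have a1 : `|expR u - 1 - u| <= e / 6 * N by apply: le_trans u1 _; rewrite ler_wpM2l// ltW.
have a2 : `|expR u * (cos v - 1)| <= 2 * (e / 6 * N).
  rewrite normrM gtr0_norm//; apply: ler_pM => //.
  by apply: le_trans v2 _; rewrite ler_wpM2l// ltW.
have a3 : `|expR u * (sin v - v)| <= 2 * (e / 6 * N).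
  rewrite normrM gtr0_norm//; apply: ler_pM => //.
  by apply: le_trans v3 _; rewrite ler_wpM2l// ltW.
have a4 : `|(expR u - 1) * v| <= e / 6 * N by rewrite normrM; apply: ler_pM.
have := ler_normD (expR u - 1 - u) (expR u * (cos v - 1)).
have := ler_normD (expR u * (sin v - v)) ((expR u - 1) * v).
lra.
Unshelve. all: by end_near. Qed.

(** The functional equation reduces the claim at [w] to the estimate of [cexp_approx] at 0. *)
Lemma derivable_cexp w : derivable cexp w 1.
Proof.
apply/cvg_ex; exists (cexp w) => /=.
apply/cvgrPdist_lt => _ /gt0_complexE[e e0 ->].
pose N := complex.Re `|cexp w|.
have N0 : 0 <= N by exact: Re_norm_ge0.
have N1 : 0 < N + 1 by rewrite ltr_wpDl.
have [|r r0 hr] := @cexp_approx (e / (N + 1)); first by rewrite divr_gt0.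
apply/nbhs_normP; exists r%:C; first by rewrite /= ltcR.
move=> h; rewrite /ball_ [X in X -> _]/= sub0r normrN ltC_norm => /hr ha h0.
rewrite [_ *: 1]mulr1 cexpD.
have -> : cexp w - h^-1 *: (cexp h * cexp w - cexp w) = - (cexp w * (cexp h - 1 - h) * h^-1).
  by rewrite -[_ *: _]/(_ * _); field.
rewrite normrN [`|_ * h^-1|]normrM [`|cexp w * _|]normrM normfV ltr_pdivrMr ?normr_gt0//.
rewrite (normC_Re (cexp w)) (normC_Re (_ - h)) (normC_Re h) -!rmorphM ltcR.
have h0' : 0 < complex.Re `|h| by rewrite -(ltcR 0) -normC_Re normr_gt0.
apply: le_lt_trans (ler_wpM2l N0 ha) _.
rewrite mulrA ltr_pM2r// mulrCA gtr_pMr// ltr_pdivrMr// mul1r; lra.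
Qed.

Lemma norm_expi (t : R) : `|expi t| = 1.
Proof. by rewrite normc_def /= cos2Dsin2 sqrtr1. Qed.

Lemma norm_cexp (w : R[i]) : `|cexp w| = (expR (complex.Re w))%:C.
Proof.
rewrite /cexp normrM norm_expi mulr1 normc_def /= expr0n addr0 sqrtr_sqr.
by rewrite gtr0_norm// expR_gt0.
Qed.

(** The map w |-> a + b exp w sends the closed half-plane Re w <= 0 into the closed disc, and the
    vertical segment of abscissa s onto the circle shrunk by exp s. The mean over that circle does
    not depend on s, and by continuity it is as close as desired to the value at the centre when s
    is very negative. *)
Lemma mean_value (U : set R[i]^o) phi (a b : R[i]^o) :
  (forall z, U z -> derivable phi z 1) ->
  (forall c : R[i], `|c| <= 1 -> U (a + c *: b)) ->
  \int[mu]_(t in `[0, 2 * pi]) complex.Re (phi (a + expi t *: b)) =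
  complex.Re (phi a) * (2 * pi).
Proof.
move=> dphi Uab.
pose g (w : R[i]^o) : R[i]^o := phi (a + b * cexp w).
have pi0 : (0 : R) < 2 * pi by rewrite mulr_gt0// pi_gt0.
have Ug w : complex.Re w <= 0 -> U (a + b * cexp w).
  move=> w0; rewrite mulrC; apply: (Uab (cexp w)).
  by rewrite norm_cexp -[leRHS]/(1%:C) lecR -[leRHS]expR0 ler_expR.
have dg w : complex.Re w <= 0 -> derivable g w 1.
  move=> w0; apply/derivable1_diffP.
  apply: (@differentiable_comp _ _ _ _ (fun w => a + b * cexp w : R[i]^o) phi).
    apply/derivable1_diffP; apply: derivableD; first exact: derivable_cst.
    by apply: derivableM; [exact: derivable_cst|exact: derivable_cexp].
  by apply/derivable1_diffP/dphi/Ug.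
have gper (t : R) : g (t +i* (2 * pi)) = g (t +i* 0).
  by rewrite /g /cexp /expi /= mulr_natl -(add0r (pi *+ 2)) cosD2pi sinD2pi.
(* The horizontal sides of [s, 0] x [0, 2 pi] cancel by periodicity, so Goursat equates the two
   vertical ones. *)
have const (s : R) : s <= 0 -> vint g 0 0 (2 * pi) = vint g s 0 (2 * pi).
  move=> s0.
  have : boundary g s 0 (- s) (2 * pi) = 0.
    by apply: goursat; [lra|exact: ltW|move=> w [/= h _]; apply: dg; lra].
  rewrite /boundary (subrr s) (add0r (2 * pi)).
  have -> : hint g s (2 * pi) (- s) = hint g s 0 (- s).
    by apply: eq_Rintegral => t _; rewrite gper.
  by rewrite subrr subr0 => /eqP; rewrite subr_eq0 => /eqP.
have -> : \int[mu]_(t in `[0, 2 * pi]) complex.Re (phi (a + expi t *: b)) = vint g 0 0 (2 * pi).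
  rewrite /vint add0r; apply: eq_Rintegral => t _.
  by rewrite /g /cexp /= expR0 mul1r mulrC.
have ca : {for a, continuous phi}.
  apply/differentiable_continuous/derivable1_diffP/dphi.
  by have := Uab 0; rewrite normr0 ler01 scale0r addr0; apply.
apply/eqP; rewrite -subr_eq0 -normr_eq0 eq_le normr_ge0 andbT.
apply/ler_addgt0Pr => e e0; rewrite add0r.
have e2 : 0 < e / (2 * pi) by rewrite divr_gt0.
have /cvgrPdist_lt/(_ (e / (2 * pi))%:C) := ca; rewrite ltcR => /(_ e2).
move=> /nbhs_normP[d /gt0_complexE[{}d d0 ->] da].
(* The cap at 1 gives [ln r <= 0]; the denominator |b| + 1 ensures |b| r < d, including when b =
   0. *)
pose r : R := Num.min 1 (d / (complex.Re `|b| + 1)).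
have b0 := Re_norm_ge0 b.
have b1 : 0 < complex.Re `|b| + 1 by rewrite ltr_wpDl.
have r0 : 0 < r by rewrite lt_min ltr01 divr_gt0.
have s0 : ln r <= 0 by rewrite ln_le0// ge_min lexx.
rewrite (const _ s0) /vint.
have -> : e = e / (2 * pi) * (2 * pi) by rewrite divfK// gt_eqF.
have := @Rintegral_approx R (fun t => complex.Re (g (ln r +i* t))) 0 (0 + 2 * pi)
  (complex.Re (phi a)) (e / (2 * pi)).
rewrite [X in X - 0]add0r subr0; apply; first by rewrite add0r ltW.
  by move=> t _; apply/continuous_vert/derivable_continuous/dg.
move=> t _; rewrite -raddfB; apply: le_trans (normRe_le _) _.
apply: ltW; rewrite -ltC_norm /g distrC; apply: da.
rewrite /ball_ /= opprD addNKr normrN normrM norm_cexp /= lnK ?posrE//.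
rewrite normC_Re -rmorphM ltcR.
apply: le_lt_trans (_ : complex.Re `|b| * (d / (complex.Re `|b| + 1)) < d).
  by rewrite ler_wpM2l// ge_min lexx orbT.
rewrite mulrCA gtr_pMr// ltr_pdivrMr// mul1r; lra.
Qed.

End MeanValue.

(** * Griffiths negativity *)

Section Griffiths.
Variable R : realType.
Local Open Scope classical_set_scope.
Local Open Scope ring_scope.
Local Open Scope complex_scope.
Local Notation mu := (@lebesgue_measure R).
Implicit Types (f : R[i]^o -> R[i]^o) (U : set R[i]^o).

Lemma sqnorm_ge0 (z : R[i]) : 0 <= sqnorm z.
Proof. by rewrite addr_ge0// sqr_ge0. Qed.

Lemma plurisubharmonic_ext U (u v : R[i]^o -> \bar R) : (forall z, U z -> u z = v z) ->
  plurisubharmonic U u -> plurisubharmonic U v.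
Proof.
move=> uv [ufin uusc umean]; split.
- by move=> z Uz; rewrite -uv//; exact: ufin.
- move=> z c Uz; rewrite -uv// => uzc; have := uusc z c Uz uzc.
  by apply: filterS => w h Uw; rewrite -uv//; exact: h.
- move=> a b ab; rewrite -uv; last first.
    by have := ab 0; rewrite normr0 ler01 scale0r addr0; apply.
  rewrite (_ : circle_mean v a b = circle_mean u a b); first exact: umean.
  rewrite /circle_mean; congr (_ * _)%E; apply: eq_integral => t _.
  by rewrite uv//; apply: ab; rewrite norm_expi.
Qed.

Lemma holomorphicD U f1 f2 : holomorphic U f1 -> holomorphic U f2 ->
  holomorphic U (fun z => f1 z + f2 z).
Proof.
move=> h1 h2 z Uz.
exact: (@derivableD R[i] R[i]^o R[i]^o f1 f2 z 1 (h1 z Uz) (h2 z Uz)).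
Qed.

Lemma holomorphicM U f1 f2 : holomorphic U f1 -> holomorphic U f2 ->
  holomorphic U (fun z => ((f1 z : R[i]) * (f2 z : R[i]))%R : R[i]).
Proof.
move=> h1 h2 z Uz.
exact: (@derivableM R[i] R[i]^o f1 f2 z 1 (h1 z Uz) (h2 z Uz)).
Qed.

Lemma holomorphic_cst U (c : R[i]^o) : holomorphic U (fun=> c).
Proof. by move=> z _; exact: (@derivable_cst R[i] R[i]^o R[i]^o c z 1). Qed.

Lemma holomorphic_id U : holomorphic U (fun z => z).
Proof. by move=> z _; exact: (@derivable_id R[i] R[i]^o z 1). Qed.

(* The sub-mean value inequality at a follows from the mean value property of the harmonic
   minorant 2 Re (conj (f1 a) f1 + conj (f2 a) f2) - |f1 a|^2 - |f2 a|^2, with equality at a. *)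
Lemma plurisubharmonic_sqnorm U f1 f2 : open U -> holomorphic U f1 -> holomorphic U f2 ->
  plurisubharmonic U (fun z : R[i]^o => (sqnorm (f1 z) + sqnorm (f2 z))%:E).
Proof.
move=> oU h1 h2.
have c1 z : U z -> {for z, continuous f1} by move=> /h1; exact: derivable_continuous.
have c2 z : U z -> {for z, continuous f2} by move=> /h2; exact: derivable_continuous.
have cs z : U z -> {for z, continuous (fun z : R[i]^o => sqnorm (f1 z) + sqnorm (f2 z))}.
  move=> Uz; apply: (@continuousD R R^o _ (fun z => sqnorm (f1 z)) (fun z => sqnorm (f2 z))).
    exact: (cvg_comp f1 (@sqnorm R : R[i]^o -> R) (c1 _ Uz) (@continuous_sqnorm R _)).
  exact: (cvg_comp f2 (@sqnorm R : R[i]^o -> R) (c2 _ Uz) (@continuous_sqnorm R _)).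
split.
- by move=> z _; rewrite ltry.
- move=> z c Uz; rewrite lte_fin => zc.
  have : \forall w \near z, sqnorm (f1 w) + sqnorm (f2 w) < c by exact: (cvgr_lt _ (cs _ Uz)).
  by apply: filterS => w ? _; rewrite lte_fin.
move=> a b ab.
have Ua : U a by have := ab 0; rewrite normr0 ler01 scale0r addr0; apply.
have Ut t : U (a + expi t *: b) by apply: ab; rewrite norm_expi.
pose u z := sqnorm (f1 z) + sqnorm (f2 z).
pose phi (z : R[i]^o) : R[i]^o :=
  ((2 * (f1 a : R[i])^* * (f1 z : R[i]) + 2 * (f2 a : R[i])^* * (f2 z : R[i])) + - (u a)%:C)%R.
have dphi : holomorphic U phi.
  have p1 := @holomorphicM U (fun=> 2 * (f1 a : R[i])^*) f1 (@holomorphic_cst U _) h1.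
  have p2 := @holomorphicM U (fun=> 2 * (f2 a : R[i])^*) f2 (@holomorphic_cst U _) h2.
  have p3 := @holomorphicD U _ _ p1 p2.
  exact: (@holomorphicD U _ _ p3 (@holomorphic_cst U (- (u a)%:C))).
(* This is |f1 z - f1 a|^2 + |f2 z - f2 a|^2 >= 0, expanded. *)
have phiu z : complex.Re (phi z) <= u z.
  rewrite /phi /u /sqnorm; case: (f1 z) (f1 a) (f2 z) (f2 a) => [x y] [xa ya] [x' y'] [xa' ya'] /=.
  have := sqr_ge0 (x - xa); have := sqr_ge0 (y - ya); have := sqr_ge0 (x' - xa').
  have := sqr_ge0 (y' - ya'); lra.
have phia : complex.Re (phi a) = u a.
  by rewrite /phi /u /sqnorm; case: (f1 a) (f2 a) => [x y] [x' y'] /=; ring.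
have ct (t : R) : (a + expi s *: b : R[i]^o) @[s --> t] --> (a + expi t *: b : R[i]^o).
  have ce : (expi s : R[i]^o) @[s --> t] --> (expi t : R[i]^o).
    by apply: cvg_complex; [exact: continuous_cos|exact: continuous_sin].
  have cb : {for (expi t : R[i]^o), continuous (fun c : R[i]^o => a + c *: b)}.
    apply: (@continuousD R[i] R[i]^o R[i]^o (fun=> a) (fun c => c *: b)).
      exact: cst_continuous.
    exact: scalel_continuous.
  exact: (cvg_comp (@expi R : R -> R[i]^o) (fun c : R[i]^o => a + c *: b) ce cb).
have iu : mu.-integrable `[0, 2 * pi] (EFin \o (fun t => u (a + expi t *: b))).
  apply: integrable_segment => t _.
  exact: (cvg_comp (fun t : R => (a + expi t *: b : R[i]^o)) u (ct t) (cs _ (Ut t))).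
have ip : mu.-integrable `[0, 2 * pi] (EFin \o (fun t => complex.Re (phi (a + expi t *: b)))).
  apply: integrable_segment => t _.
  have := derivable_continuous (dphi _ (Ut t)).
  move=> /(cvg_comp (fun t : R => (a + expi t *: b : R[i]^o)) phi (ct t)) h.
  exact: (cvg_comp (fun t : R => phi (a + expi t *: b))
    (@complex.Re R : R[i]^o -> R) h (@continuous_Re R _)).
have pi0 : (0 : R) < 2 * pi by rewrite mulr_gt0// pi_gt0.
have le : complex.Re (phi a) * (2 * pi) <= \int[mu]_(t in `[0, 2 * pi]) u (a + expi t *: b).
  by rewrite -(mean_value dphi ab); apply: le_Rintegral.
rewrite /circle_mean (_ : (\int[mu]_(t in _) _)%E =
    (\int[mu]_(t in `[0, 2 * pi]) u (a + expi t *: b))%:E); last first.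
  by rewrite /Rintegral fineK//; exact: integrable_fin_num iu.
by rewrite -EFinM lee_fin ler_pdivlMl// mulrC -/(u a) -phia.
Qed.

Definition hmx (z : R[i]) : 'M[R[i]]_2 :=
  mx2 (1 + `|z| ^+ 2) z (Num.conj z) (`|z| ^+ 2).

Lemma hform_hmx z (s : 'cV[R[i]]_2) :
  hform (hmx z) s s = (sqnorm (z * s 0 0) + sqnorm (s 0 0 + z * s 1 0))%:C.
Proof.
rewrite /hform /hmx -!sqnormE conjE mxE !big_ord_recl big_ord0 !mxE.
rewrite !big_ord_recl !big_ord0 !mxE /= (_ : lift ord0 ord0 = 1); last exact/val_inj.
rewrite !conjE /sqnorm.
case: (s 0 0) (s 1 0) z => [a b] [c d] [x y].
by apply: complexP => /=; ring.
Qed.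

Lemma griffiths_hmx (h : R[i] -> 'M[R[i]]_2) :
  (forall z, unit_disc z -> h z = hmx z) -> griffiths_negative unit_disc h.
Proof.
move=> hE U u oU UD hu.
apply: (@plurisubharmonic_ext U
  (fun z => (sqnorm (z * u z 0 0) + sqnorm (u z 0 0 + z * u z 1 0))%:E)).
  by move=> z /UD zD; rewrite hE// hform_hmx.
have zu i := holomorphicM (@holomorphic_id U) (hu i).
exact: (plurisubharmonic_sqnorm oU (zu 0) (holomorphicD (hu 0) (zu 1))).
Qed.

End Griffiths.

(** * Connection matrix *)

Section Connection.
Variable R : realType.
Local Open Scope classical_set_scope.
Local Open Scope ring_scope.
Local Open Scope complex_scope.
Variable h : R[i] -> 'M[R[i]]_2.
Hypothesis hE : forall z : R[i], unit_disc z -> h z = hmx z.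
Local Notation plane := (measurableTypeR R * measurableTypeR R)%type.

Lemma ord2_case (k : 'I_2) : k = 0 \/ k = 1.
Proof. by case: k => [[|[|k]]//= klt]; [left|right]; exact/val_inj. Qed.

Lemma hmx_unit (z : R[i]) : z != 0 -> hmx z \in unitmx.
Proof.
move=> z0; have s0 : z^* != 0 by rewrite conjc_eq0.
(* The determinant is |z|^4; the candidate inverse is the adjugate divided by it, with |z|^2 written
   as z times its conjugate. *)
have : hmx z *m mx2 (z * z^*)^-1 (- (z * z^* ^+ 2)^-1) (- (z ^+ 2 * z^*)^-1)
   ((1 + z * z^*) * ((z * z^*) ^+ 2)^-1) = 1%:M.
  apply/matrixP => i j; rewrite mxE !big_ord_recl big_ord0 !mxE.
  rewrite (_ : lift ord0 ord0 = 1); last exact/val_inj.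
  rewrite conjE !sqr_normc.
  case: i j => [[|[|i]]//= ilt] [[|[|j]]//= jlt]; rewrite addr0 /=; field;
    rewrite z0 s0 //.
by move/mulmx1_unit => [].
Qed.

Lemma connection_hmx (z : R[i]) : unit_disc z -> z != 0 ->
  connection_matrix h z = mx2 z^-1 0 (- (z ^+ 2)^-1) z^-1.
Proof.
move=> zD z0; rewrite /connection_matrix hE//.
have hn i j : \forall w \near (z : R[i]^o), hmx w i j = h w i j.
  near=> w; rewrite hE//; near: w.
  by apply: open_nbhs_nbhs; split => //; exact: open_unit_disc.
have wE i j p q : wd (fun w => hmx w i j) z p q -> wirtinger_dz (fun w => h w i j) z = p.
  by move=> /(near_wd (hn i j)) /wd_dz.
have wN : wd (fun w => w * w^*) z z^* z.
  by apply: wd_eq (wd_mul (wd_id z) (wd_conj z)) _ _;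
    rewrite ?mul1r ?mulr1 ?mulr0 ?mul0r ?addr0 ?add0r.
have w00 : wirtinger_dz (fun w => h w 0 0) z = z^*.
  apply: (wE _ _ _ z).
  rewrite (_ : (fun w => _) = fun w => 1 + w * w^*); last first.
    by apply/funext => w; rewrite mxE /= sqr_normc.
  by apply: wd_eq (wd_add (wd_cst 1 z) wN) _ _; rewrite add0r.
have w01 : wirtinger_dz (fun w => h w 0 1) z = 1.
  apply: (wE _ _ _ 0).
  rewrite (_ : (fun w => _) = id); first exact: wd_id.
  by apply/funext => w; rewrite mxE.
have w10 : wirtinger_dz (fun w => h w 1 0) z = 0.
  apply: (wE _ _ _ 1).
  rewrite (_ : (fun w => _) = conjc); first exact: wd_conj.
  by apply/funext => w; rewrite mxE.
have w11 : wirtinger_dz (fun w => h w 1 1) z = z^*.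
  apply: (wE _ _ _ z).
  rewrite (_ : (fun w => _) = fun w => w * w^*) //.
  by apply/funext => w; rewrite mxE /= sqr_normc.
(* Factoring the inverse metric out of the right-hand side reduces the claim to the polynomial-like
   identity dh = h theta, free of inverse matrices. *)
rewrite -[RHS](mulKmx (hmx_unit z0)); congr (_ *m _).
apply/matrixP => i j; rewrite [LHS]mxE [RHS]mxE !big_ord_recl big_ord0.
have -> : lift ord0 ord0 = 1 :> 'I_2 by exact/val_inj.
have [] := ord2_case i; have [] := ord2_case j => -> ->;
  rewrite ?w00 ?w01 ?w10 ?w11 !mxE /= ?conjE ?sqr_normc; field.
all: rewrite ?z0//.
Unshelve. all: by end_near. Qed.

Lemma measurable_sqnorm : measurable_fun setT (fun p : plane => sqnorm (to_complex p)).
Proof.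
by apply: measurable_funD; apply: measurable_funX; [exact: measurable_fst|exact: measurable_snd].
Qed.

Lemma measurable_to_plane_sqnorm (A : set R) : measurable A ->
  measurable (to_plane [set z : R[i]^o | A (sqnorm z)]).
Proof.
by move=> mA; rewrite -[X in measurable X]setTI; exact: measurable_sqnorm.
Qed.

Lemma measurable_unit_disc : measurable (to_plane (@unit_disc R)).
Proof.
rewrite (_ : to_plane _ = to_plane [set z : R[i]^o | `]-oo, 1[%classic (sqnorm z)]).
  by apply: measurable_to_plane_sqnorm.
by apply/funext => p; rewrite /to_plane /= unit_discE in_itv.
Qed.

Lemma measurable_disc (r : R) : measurable (to_plane (disc r)).
Proof.
rewrite (_ : to_plane _ = to_plane [set z : R[i]^o | `]-oo, r]%classic (sqnorm z)]).
  by apply: measurable_to_plane_sqnorm.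
by apply/funext => p; rewrite /to_plane /= in_itv.
Qed.

Lemma hermitian_hmx : singular_hermitian_metric unit_disc h.
Proof.
split=> [z zD|].
  rewrite hE//; split.
    apply/is_hermitianmxP; rewrite expr0 scale1r; apply/matrixP => i j.
    have [] := ord2_case i; have [] := ord2_case j => -> ->;
      rewrite !mxE /= ?conjE ?conjcK// -sqnormE.
      by rewrite -[1]/(1%:C) -rmorphD conjc_real.
    by rewrite conjc_real.
  by move=> s; rewrite hform_hmx ler0c addr_ge0// sqnorm_ge0.
move=> i j.
suff : cmeasurable (@unit_disc R) (fun z => hmx z i j).
  move=> [mr mi].
  split.
    apply: eq_measurable_fun mr => p; rewrite inE => pD.
    by rewrite /re_part hE.
  apply: eq_measurable_fun mi => p; rewrite inE => pD.
  by rewrite /im_part hE.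
have mx : measurable_fun (to_plane (@unit_disc R)) (fun p : plane => p.1).
  by apply: measurable_funTS; exact: measurable_fst.
have my : measurable_fun (to_plane (@unit_disc R)) (fun p : plane => p.2).
  by apply: measurable_funTS; exact: measurable_snd.
have ms : measurable_fun (to_plane (@unit_disc R)) (fun p : plane => sqnorm (to_complex p)).
  by apply: measurable_funTS; exact: measurable_sqnorm.
have E (p : R * R) : [/\ hmx (to_complex p) 0 0 = (1 + sqnorm (to_complex p))%:C,
    hmx (to_complex p) 0 1 = p.1 +i* p.2, hmx (to_complex p) 1 0 = p.1 -i* p.2 &
    hmx (to_complex p) 1 1 = (sqnorm (to_complex p))%:C].
  by split; rewrite mxE /= -?sqnormE ?rmorphD ?rmorph1 ?conjE.
have E00 (p : R * R) : hmx (to_complex p) 0 0 = (1 + sqnorm (to_complex p))%:C by have [] := E p.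
have E01 (p : R * R) : hmx (to_complex p) 0 1 = p.1 +i* p.2 by have [] := E p.
have E10 (p : R * R) : hmx (to_complex p) 1 0 = p.1 -i* p.2 by have [] := E p.
have E11 (p : R * R) : hmx (to_complex p) 1 1 = (sqnorm (to_complex p))%:C by have [] := E p.
rewrite /cmeasurable /re_part /im_part.
have [] := ord2_case i; have [] := ord2_case j => -> ->; split;
  under eq_fun do rewrite ?E00 ?E01 ?E10 ?E11 /=; rewrite //.
- exact: measurable_funD.
- exact: measurable_cst.
- exact: measurable_funN.
- exact: measurable_cst.
Qed.

End Connection.

(** * Non-integrability of the connection *)

Section NotIntegrable.
Variable R : realType.
Local Open Scope classical_set_scope.
Local Open Scope ring_scope.
Local Open Scope complex_scope.
Variable h : R[i] -> 'M[R[i]]_2.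
Hypothesis hE : forall z : R[i], unit_disc z -> h z = hmx z.
Local Notation plane := (measurableTypeR R * measurableTypeR R)%type.

(** The box lies in the sector 0 <= y <= x / 2, where Re (z^2) is comparable to |z|^2, so the real
    part of -1/z^2 keeps a constant sign and the full order of magnitude. Scaling by [s] makes area
    times size of the integrand independent of [s]. *)
Definition box (s : R) : set plane := `[s, 2 * s] `*` `[0, s / 2].

Lemma measurable_box s : measurable (box s).
Proof. by apply: measurableX; exact: measurable_itv. Qed.

Lemma measure_box s : 0 < s -> plane_measure R (box s) = (s ^+ 2 / 2)%:E.
Proof.
move=> s0; rewrite /plane_measure /= product_measure1E//=.
have := @lebesgue_measure_itv R `[s, 2 * s]; rewrite /= lte_fin ifT; last lra.
move=> ->; have := @lebesgue_measure_itv R `[0, s / 2]; rewrite /= lte_fin ifT; last lra.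
by move=> ->; rewrite -EFinB -EFinM; congr EFin; field.
Qed.

Lemma box_sub (s : R) : 0 < s -> s <= 1 / 8 -> box s `<=` to_plane (disc (1 / 4)).
Proof.
move=> s0 s8 [x y] [/=]; rewrite !in_itv /= => /andP[x1 x2] /andP[y1 y2].
rewrite /to_plane /disc /sqnorm /=.
have : x ^+ 2 <= (2 * s) ^+ 2 by rewrite ler_sqr ?nnegrE; lra.
have : y ^+ 2 <= (s / 2) ^+ 2 by rewrite ler_sqr ?nnegrE; lra.
have : s ^+ 2 <= (1 / 8) ^+ 2 by rewrite ler_sqr ?nnegrE; lra.
lra.
Qed.

Lemma entry_lower_bound (s : R) (p : plane) : 0 < s -> s <= 1 / 8 -> box s p ->
  25^-1 / s ^+ 2 <= `|re_part (fun z => connection_matrix h z 1 0) p|.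
Proof.
move=> s0 s8 ps; have := box_sub s0 s8 ps.
have d1 : 1 / 4 < 1 :> R by lra.
move=> /(disc_sub_unit d1) pD; move: ps; case: p pD => x y pD [/=].
rewrite !in_itv /= => /andP[x1 x2] /andP[y1 y2].
have z0 : to_complex (x, y) != 0 :> R[i].
  by apply/eqP => -[x0 _]; move: s0 x1; rewrite x0; lra.
rewrite /re_part connection_hmx// mxE /=.
have -> : (x * x - y * y) ^+ 2 + (x * y + y * x) ^+ 2 = (x ^+ 2 + y ^+ 2) ^+ 2 by ring.
rewrite -!expr2; set a := x ^+ 2; set b := y ^+ 2; set S := s ^+ 2.
have S0 : 0 < S by rewrite exprn_gt0.
have a1 : S <= a by rewrite ler_sqr ?nnegrE; lra.
have a2 : a <= 4 * S.
  have -> : 4 * S = (2 * s) ^+ 2 by rewrite /S; ring.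
  by rewrite ler_sqr ?nnegrE; lra.
have b0 : 0 <= b by exact: sqr_ge0.
have b1 : b <= S / 4.
  have -> : S / 4 = (s / 2) ^+ 2 by rewrite /S; field.
  by rewrite ler_sqr ?nnegrE; lra.
rewrite normrN ger0_norm ?divr_ge0 ?sqr_ge0//; last lra.
rewrite ler_pdivlMr ?exprn_gt0//; last lra.
rewrite mulrAC ler_pdivrMr// ler_pdivrMl//.
(* The first factor uses a <= 4 S and b <= S / 4. The second inequality amounts to 4 b <= a, which
   holds since b <= S / 4 and S <= a. *)
have : (a + b) * (a + b) <= (5 * S) * (5 / 3 * (a - b)).
  by apply: ler_pM; lra.
rewrite -expr2 => /le_trans; apply.
rewrite (_ : 5 * S * (5 / 3 * (a - b)) = 25 / 3 * ((a - b) * S)); last by field.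
by rewrite ler_wpM2r// ?mulr_ge0//; lra.
Qed.

(** Absolute continuity of the integral is contradicted: the area s^2 / 2 of the box tends to 0,
    while the integral over it is at least (25^-1 / s^2) (s^2 / 2) = 50^-1. The bound s <= 1/8 keeps
    the box in the disc of radius 1/2. *)
Lemma not_locally_integrable : ~ locally_integrable_mx unit_disc (connection_matrix h).
Proof.
move=> /(_ 1 0); pose K : set R[i]^o := disc (1 / 4).
have K1 : 1 / 4 < 1 :> R by lra.
move=> /(_ K (compact_disc (ltW K1)) (disc_sub_unit K1))[+ _].
set f := re_part _ => fK.
have mK := measurable_disc (1 / 4 : R).
have fT : (plane_measure R).-integrable setT (EFin \o (f \_ (to_plane K))).
  by rewrite -restrict_EFin -integrable_mkcond.
have [|d [d0 fd]] := integral_normr_continuous fT (e := 50^-1); first by rewrite invr_gt0.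
pose s := Num.min (1 / 8) d.
have s0 : 0 < s by rewrite lt_min d0 andbT; lra.
have s8 : s <= 1 / 8 by rewrite ge_min lexx.
have mB := measurable_box s.
have := fd _ mB; rewrite measure_box// lte_fin.
have sd : s ^+ 2 / 2 < d.
  have : s <= d by rewrite ge_min lexx orbT.
  rewrite expr2; nra.
move=> /(_ sd); apply/negP; rewrite -leNgt.
have BK : box s `<=` to_plane K by exact: box_sub.
rewrite (_ : 50^-1 = \int[plane_measure R]_(p in box s) (25^-1 / s ^+ 2)); last first.
  rewrite Rintegral_cst//= measure_box//=; field.
  by rewrite gt_eqF.
apply: le_Rintegral => //.
- apply/integrableP; split; first exact/measurable_EFinP.
  by under eq_integral do rewrite /=; rewrite integral_cst//= measure_box// -EFinM ltry.
- have := integrable_abse (integrableS measurableT mB (@subsetT _ _) fT).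
  by [].
- move=> p pB; rewrite patchE mem_set; last exact: BK.
  exact: entry_lower_bound.
Qed.

End NotIntegrable.

(** * Test functions *)

Section Bump.
Variable R : realType.
Local Open Scope classical_set_scope.
Local Open Scope ring_scope.
Local Open Scope complex_scope.

(* Up to polynomial factors in 1/x, the derivatives of the flat function exp(-1/x). *)
Definition flat (k : nat) (x : R) : R := if 0 < x then x ^- k * expR (- x^-1) else 0.

Lemma flat_ge0 k x : 0 <= flat k x.
Proof.
rewrite /flat; case: ifPn => // x0.
by rewrite mulr_ge0 ?expR_ge0// invr_ge0 exprn_ge0// ltW.
Qed.

Lemma flat_le0 k x : x <= 0 -> flat k x = 0.
Proof. by move=> x0; rewrite /flat ltNge x0. Qed.

(** With y = 1/x, one term of the exponential series gives y^(k+2) <= (k+2)! exp y. A quadratic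
    bound is what makes the derivative at 0 exist and vanish. *)
Lemma flat_bound k x : flat k x <= k.+2`!%:R * x ^+ 2.
Proof.
have [x0|x0] := leP x 0.
  by rewrite flat_le0// mulr_ge0 ?sqr_ge0.
rewrite /flat x0; set m := k.+2; pose y := x^-1.
have y0 : 0 < y by rewrite invr_gt0.
have ym : y ^+ m <= m`!%:R * expR y.
  rewrite mulrC -ler_pdivrMr ?ltr0n ?fact_gt0//.
  by apply: le_trans (expR_ge1Dxn k.+1 (ltW y0)); rewrite lerDr.
have -> : x ^- k * expR (- x^-1) = x ^+ 2 * (y ^+ m / expR y).
  rewrite expRN -exprVn -/y (_ : y ^+ m = y ^+ k * y ^+ 2); last by rewrite -exprD addn2.
  have xy : x ^+ 2 * y ^+ 2 = 1 by rewrite -exprMn divff ?gt_eqF// expr1n.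
  by rewrite [RHS]mulrA [x ^+ 2 * _]mulrCA xy mulr1.
rewrite mulrC ler_wpM2r ?sqr_ge0//.
by rewrite ler_pdivrMr// expR_gt0.
Qed.

Lemma is_derive_sqr_bound (f : R -> R) (C : R) : (forall t, `|f t| <= C * t ^+ 2) ->
  is_derive (0 : R) 1 f 0.
Proof.
move=> fC.
have C1 : 0 < `|C| + 1 by rewrite ltr_wpDl.
have f0 : f 0 = 0.
  by apply/eqP; rewrite -normr_le0; have := fC 0; rewrite expr2 !mulr0.
have cv : h^-1 *: (f (h *: 1 + 0) - f 0) @[h --> (0 : R)^'] --> (0 : R).
  apply/cvgrPdist_lt => e e0; apply/nbhs_normP; exists (e / (`|C| + 1)) => /=.
    by rewrite divr_gt0.
  move=> t /=; rewrite sub0r normrN => te t0.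
  rewrite f0 subr0 addr0 [_ *: 1]mulr1 sub0r normrN normrM normfV.
  rewrite mulrC ltr_pdivrMr ?normr_gt0//; apply: le_lt_trans (fC t) _.
  rewrite -real_normK ?num_real// expr2 mulrA ltr_pM2r ?normr_gt0//.
  rewrite ltr_pdivlMr// in te; apply: le_lt_trans te.
  rewrite mulrC ler_wpM2l//; have := ler_norm C; lra.
split; first by apply/cvg_ex; exists 0.
exact: cvg_lim cv.
Qed.

(** Differentiation keeps the family within its linear span. The function is locally constant for x
    < 0, the usual rules apply for x > 0, and at the gluing point 0 the quadratic bound takes
    over. *)
Lemma is_derive_flat (k : nat) (x : R) :
  is_derive x 1 (flat k) (flat k.+2 x - k%:R * flat k.+1 x).
Proof.
have [x0|x0|->] := ltgtP x 0.
- rewrite !flat_le0 ?ltW// mulr0 subr0.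
  apply: (@near_eq_is_derive R R R _ _ _ _ _ _ (is_derive_cst (0 : R) x 1)).
  near=> t; rewrite flat_le0//; apply: ltW; near: t; exact: lt_nbhsl.
- have xn : x != 0 by rewrite gt_eqF.
  have dV : is_derive x 1 (fun y : R => y^-1) (- x ^- 2).
    have := @is_deriveV R id x 1 1 xn (is_derive_id _ _).
    by rewrite [_ *: 1]mulr1.
  have dX := @is_deriveX R R (fun y : R => y^-1) k x 1 _ dV.
  have dE := @is_derive1_comp R (@expR R) (- (fun y : R => y^-1)) x _ _
    (is_derive_expR _) (is_deriveN dV).
  have dM := @is_deriveM R R _ _ x 1 _ _ dX dE.
  apply: (@near_eq_is_derive R R R _ _ _ _ _ _ (is_derive_eq dM _)).
    near=> t; rewrite /flat ifT; last by near: t; exact: lt_nbhsr.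
    by rewrite -exprVn mulrfctE exprfctE.
  rewrite /flat x0 exprfctE /comp opprfctE -!exprVn -![_ *: _]/(_ * _).
  by case: k {dX dM} => [|k]; rewrite ?mul0r ?subr0 /= ?mulr0 !exprS; ring.
- rewrite !flat_le0// mulr0 subr0; apply: (@is_derive_sqr_bound _ k.+2`!%:R) => t.
  by rewrite ger0_norm ?flat_ge0 ?flat_bound.
Unshelve. all: by end_near. Qed.

Lemma continuous_flat k : continuous (flat k).
Proof.
move=> x; apply/differentiable_continuous/derivable1_diffP.
exact: (@ex_derive _ _ _ _ _ _ _ (is_derive_flat k x)).
Qed.

Variable r : R.

(* Generated by z, its conjugate and the flat functions of [r - |z|^2], this algebra is closed
   under differentiation. *)
Inductive bumpy : (R[i] -> R[i]) -> Prop :=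
| bumpy_cst c : bumpy (fun=> c)
| bumpy_id : bumpy id
| bumpy_conj : bumpy conjc
| bumpy_add f g : bumpy f -> bumpy g -> bumpy (fun z => f z + g z)
| bumpy_mul f g : bumpy f -> bumpy g -> bumpy (fun z => f z * g z)
| bumpy_flat k : bumpy (fun z => (flat k (r - sqnorm z))%:C).

Lemma wd_flat k z : wd (fun z => (flat k (r - sqnorm z))%:C) z
  ((k%:R * flat k.+1 (r - sqnorm z) - flat k.+2 (r - sqnorm z))%:C * z^*)
  ((k%:R * flat k.+1 (r - sqnorm z) - flat k.+2 (r - sqnorm z))%:C * z).
Proof.
apply: (@wd_radial R (fun s => flat k (r - s)) z).
have dr : is_derive (sqnorm z) 1 (fun s : R => r - s) (-1).
  have := is_derive_affine r (-1) (sqnorm z).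
  by rewrite (_ : (fun t : R => r + t * -1) = (fun s => r - s))//;
    apply/funext => t; rewrite mulrN1.
have := @is_derive1_comp R (flat k) (fun s => r - s) (sqnorm z) _ _ (is_derive_flat k _) dr.
by rewrite mulrN1 opprB.
Qed.

Lemma bumpy_wd f : bumpy f ->
  exists p q, [/\ bumpy p, bumpy q & forall z, wd f z (p z) (q z)].
Proof.
elim=> {f} [c||| f g _ [p [q [bp bq fpq]]] _ [p' [q' [bp' bq' gpq]]]
  | f g bf [p [q [bp bq fpq]]] bg [p' [q' [bp' bq' gpq]]] | k].
- exists (fun=> 0), (fun=> 0); split; try exact: bumpy_cst.
  by move=> z; exact: wd_cst.
- exists (fun=> 1), (fun=> 0); split; try exact: bumpy_cst.
  by move=> z; exact: wd_id.
- exists (fun=> 0), (fun=> 1); split; try exact: bumpy_cst.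
  by move=> z; exact: wd_conj.
- exists (fun z => p z + p' z), (fun z => q z + q' z).
  split; try exact: bumpy_add.
  by move=> z; exact: wd_add.
- exists (fun z => p z * g z + f z * p' z), (fun z => q z * g z + f z * q' z).
  split; try by apply: bumpy_add; apply: bumpy_mul.
  by move=> z; exact: wd_mul.
- pose u z : R[i] := (k%:R : R)%:C * (flat k.+1 (r - sqnorm z))%:C +
    (-1) * (flat k.+2 (r - sqnorm z))%:C.
  have bu : bumpy u.
    by apply: bumpy_add; apply: bumpy_mul; try exact: bumpy_flat; exact: bumpy_cst.
  exists (fun z => u z * z^*), (fun z => u z * z); split.
  + by apply: bumpy_mul => //; exact: bumpy_conj.
  + by apply: bumpy_mul => //; exact: bumpy_id.
  + move=> z; apply: wd_eq (wd_flat k z) _ _; rewrite /u rmorphB rmorphM mulN1r//.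
Qed.

Lemma bumpy_rderive f v : bumpy f -> bumpy (rderive v f).
Proof.
move=> /bumpy_wd[p [q [bp bq fpq]]].
rewrite (_ : rderive v f = fun z => p z * v + q z * v^*).
  by apply: bumpy_add; apply: bumpy_mul => //; exact: bumpy_cst.
by apply/funext => z; exact: rd_rderive (fpq z v).
Qed.

Lemma bumpy_rderivable f v z : bumpy f -> rderivable f v z.
Proof.
by move=> /bumpy_wd[p [q [_ _ fpq]]]; exact: rd_rderivable (fpq z v).
Qed.

Lemma bumpy_continuous f : bumpy f -> continuous (f : R[i]^o -> R[i]^o).
Proof.
elim=> {f} [c||| f g _ cf _ cg | f g _ cf _ cg | k] z.
- exact: cst_continuous.
- exact: cvg_id.
- rewrite (_ : conjc = fun w : R[i] => complex.Re w -i* complex.Im w); last first.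
    by apply/funext => -[].
  have cN : {for z, continuous (fun w : R[i]^o => - complex.Im w)}.
    by apply: (@continuousN R R^o R[i]^o (fun w : R[i]^o => complex.Im w)); exact: continuous_Im.
  exact: (@cvg_complex R R[i]^o (nbhs z) (nbhs_filter z)
    (fun w : R[i] => complex.Re w -i* complex.Im w) (complex.Re z -i* complex.Im z)
    (@continuous_Re R z) cN).
- exact: (@continuousD R[i] R[i]^o R[i]^o f g z (cf z) (cg z)).
- exact: (@continuousM R[i] R[i]^o f g z (cf z) (cg z)).
- have c1 : {for z, continuous (fun z : R[i]^o => r - sqnorm z)}.
    apply: (@continuousB R R^o R[i]^o (fun=> r) (fun z => sqnorm z)).
      exact: cst_continuous.
    exact: continuous_sqnorm.
  have c2 := cvg_comp (fun z : R[i]^o => r - sqnorm z) (flat k) c1 (@continuous_flat k _).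
  have c0 : {for z, continuous (fun _ : R[i]^o => 0 : R)} by exact: cst_continuous.
  exact: (@cvg_complex R R[i]^o (nbhs z) (nbhs_filter z)
    (fun z => (flat k (r - sqnorm z))%:C) ((flat k (r - sqnorm z))%:C) c2 c0).
Qed.

(** Any word of partial derivatives stays in the algebra, so continuity and one differentiation of
    its members are enough. *)
Lemma bumpy_smooth f : bumpy f -> smooth f.
Proof.
move=> bf w /=.
have bg : bumpy (foldr (fun b : bool => rderive (if b then 1 else 'i)) f w).
  by elim: w => //= b w; exact: bumpy_rderive.
by split; [exact: bumpy_continuous|move=> z; exact: bumpy_rderivable..].
Qed.

Definition bump (z : R[i]) : R[i] := z * (flat 0 (r - sqnorm z))%:C.

Lemma bump_test_function (X : set R[i]^o) : r <= 1 -> disc r `<=` X -> test_function X bump.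
Proof.
move=> r1 rX; split.
  by apply/bumpy_smooth/bumpy_mul; [exact: bumpy_id|exact: bumpy_flat].
exists (disc r); split=> //; first exact: compact_disc.
by move=> z /negP; rewrite -ltNge => rz; rewrite /bump flat_le0 ?mulr0// subr_le0 ltW.
Qed.

(** With chi = [flat 0], one has chi' = [flat 2] and chi'' = [flat 4] - 2 [flat 3]. This is s
    chi''(r - s) - 2 chi'(r - s), the second derivative in s of s chi(r - s). *)
Definition bump_density (s : R) : R :=
  s * (flat 4 (r - s) - 2 * flat 3 (r - s)) - 2 * flat 2 (r - s).

Lemma bump_laplacian z :
  wirtinger_dz (wirtinger_dzbar bump) z = z * (bump_density (sqnorm z))%:C.
Proof.
have -> : wirtinger_dzbar bump = fun z => -1 * (z * z) * (flat 2 (r - sqnorm z))%:C.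
  apply/funext => w; have := wd_dzbar (wd_mul (wd_id w) (wd_flat 0 w)).
  by rewrite -/bump => ->; rewrite mul0r add0r !mul0r sub0r; ring.
have := wd_dz (wd_mul (wd_mul (wd_cst (-1) z) (wd_mul (wd_id z) (wd_id z))) (wd_flat 2 z)).
move=> ->; apply: complexP; rewrite /bump_density /sqnorm; case: (z) => x y /=; ring.
Qed.

(** The first derivative in s of s chi(r - s), with chi = [flat 0]: it equals chi(r) at s = 0 and 0
    at s = r. *)
Definition bump_primitive (s : R) : R := flat 0 (r - s) - s * flat 2 (r - s).

Lemma is_derive_bump_primitive (s : R) : is_derive s 1 bump_primitive (bump_density s).
Proof.
have dr : is_derive s 1 (fun s : R => r - s) (-1).
  have := is_derive_affine r (-1) s.
  by rewrite (_ : (fun t : R => r + t * -1) = (fun s => r - s))//;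
    apply/funext => t; rewrite mulrN1.
have d0 := @is_derive1_comp R (flat 0) (fun s => r - s) s _ _ (is_derive_flat 0 _) dr.
have d2 := @is_derive1_comp R (flat 2) (fun s => r - s) s _ _ (is_derive_flat 2 _) dr.
have d3 := @is_deriveM R R id (flat 2 \o (fun s => r - s)) s 1 _ _ (is_derive_id s 1) d2.
have d4 := @is_deriveB R R R _ _ s 1 _ _ d0 d3.
apply: (@is_derive_eq R R R _ _ _ _ _ d4).
by rewrite /bump_density -![_ *: _]/(_ * _) /=; ring.
Qed.

Lemma bump_density0 s : r <= s -> bump_density s = 0.
Proof. by move=> rs; rewrite /bump_density !flat_le0 ?subr_le0//; ring. Qed.

Lemma continuous_bump_density : continuous bump_density.
Proof.
have cf (k : nat) (s : R) : {for s, continuous (fun s => flat k (r - s))}.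
  have c1 : {for s, continuous (fun s : R => r - s)}.
    by apply: (@continuousB R R^o R); [exact: cst_continuous|exact: cvg_id].
  exact: (cvg_comp (fun s : R => r - s) (flat k) c1 (@continuous_flat k _)).
move=> s.
have c2 : {for s, continuous (fun _ : R => 2 : R)} by exact: cst_continuous.
have ci : {for s, continuous (fun s : R => s)} by exact: cvg_id.
exact: (@continuousB R R^o R _ _ s
  (@continuousM R R _ _ s ci
    (@continuousB R R^o R _ _ s (cf 4 s) (@continuousM R R _ _ s c2 (cf 3 s))))
  (@continuousM R R _ _ s c2 (cf 2 s))).
Qed.

End Bump.

(** * Radial integrals in the plane *)

Section Polar.
Variable R : realType.
Local Open Scope classical_set_scope.
Local Open Scope ring_scope.
Local Open Scope complex_scope.
Local Notation mu := (@lebesgue_measure R).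
Local Notation plane := (measurableTypeR R * measurableTypeR R)%type.

Section nonnegative.
Variables (G : R -> R) (r : R).
Hypotheses (cG : continuous G) (G0 : forall s, 0 <= G s) (r0 : 0 <= r).
Hypothesis Gr : forall s, r <= s -> G s = 0.

Lemma is_derive_scale (a x : R) : is_derive x 1 (fun t : R => a * t) a.
Proof.
have := is_derive_affine 0 a x.
by rewrite (_ : (fun t => _) = (fun t => a * t))//; apply/funext => t; rewrite add0r mulrC.
Qed.

Lemma derive1_scale (a : R) : derive1 (fun t : R => a * t) = cst a.
Proof. by apply/funext => x; rewrite derive1E; have [_ ->] := is_derive_scale a x. Qed.

(** The substitution is y = |x| t, under which x^2 + y^2 = x^2 (1 + t^2); the absolute value keeps
    it increasing for either sign of [x]. *)
Lemma integral_line (x : R) : x != 0 ->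
  (\int[mu]_y (G (x ^+ 2 + y ^+ 2))%:E =
   \int[mu]_t (`|x| * G (x ^+ 2 * oneDsqr t))%:E)%E.
Proof.
move=> x0; have nx : 0 < `|x| by rewrite normr_gt0.
have cG2 : continuous (fun y : R => G (x ^+ 2 + y ^+ 2)).
  move=> y; have c1 : {for y, continuous (fun y : R => x ^+ 2 + y ^+ 2)}.
    apply: (@continuousD R R^o R (fun=> x ^+ 2) (fun y => y ^+ 2)).
      exact: cst_continuous.
    exact: exprn_continuous.
  have cGy : {for x ^+ 2 + y ^+ 2, continuous G} by exact: cG.
  exact: (@continuous_comp R R R (fun y : R => x ^+ 2 + y ^+ 2) G y c1 cGy).
rewrite (@increasing_ge0_integration_by_substitutionT R (fun t => `|x| * t)).
- apply: eq_integral => t _; rewrite derive1_scale; congr EFin.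
  rewrite /= mulrC; congr (_ * G _).
  by rewrite exprMn real_normK ?num_real// /oneDsqr mulrDr mulr1.
- by move=> a b ab; rewrite ltr_pM2l.
- by rewrite derive1_scale; exact: cst_continuous.
- by rewrite derive1_scale; exact: is_cvg_cst.
- by rewrite derive1_scale; exact: is_cvg_cst.
- by move=> t; exact: (@ex_derive _ _ _ _ _ _ _ (is_derive_scale _ t)).
- exact: gt0_cvgMrNy.
- exact: gt0_cvgMry.
- exact: cG2.
- by move=> y; exact: G0.
Qed.

(** By evenness the integral is twice the one over x >= 0, where s = c x^2 gives ds = 2 c x dx. The
    integrand vanishes beyond [b], the point with c b^2 = r, so the substitution takes place on a
    bounded interval. *)
Lemma integral_parabola (c : R) : 0 < c ->
  (\int[mu]_(x in [set: R]) (`|x| * G (x ^+ 2 * c))%:E =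
   (c^-1)%:E * \int[mu]_(s in `[0%R, r]) (G s)%:E)%E.
Proof.
move=> c0.
pose b := Num.sqrt (r / c).
have b2 : c * b ^+ 2 = r by rewrite sqr_sqrtr ?divr_ge0// ?ltW// mulrC divfK// gt_eqF.
have b0 : 0 <= b by exact: sqrtr_ge0.
have cG2 : continuous (fun x : R => `|x| * G (x ^+ 2 * c)).
  move=> x; have c1 : {for x, continuous (fun x : R => x ^+ 2 * c)}.
    apply: (@continuousM R R (fun x => x ^+ 2) (fun=> c)).
      exact: exprn_continuous.
    exact: cst_continuous.
  have cGx : {for x ^+ 2 * c, continuous G} by exact: cG.
  have c2 := @continuous_comp R R R (fun x : R => x ^+ 2 * c) G x c1 cGx.
  have c3 : {for x, continuous (fun x : R => `|x|)} by exact: norm_continuous.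
  exact: (@continuousM R R (fun x => `|x|) (fun x => G (x ^+ 2 * c)) x c3 c2).
rewrite ge0_symfun_integralT//; last 2 first.
- by move=> x; rewrite mulr_ge0.
- by move=> x /=; rewrite normrN sqrrN.
rewrite -set_itvcy.
have -> : (\int[mu]_(x in `[0%R, +oo[) (`|x| * G (x ^+ 2 * c))%:E =
    \int[mu]_(x in `[0%R, b]) (`|x| * G (x ^+ 2 * c))%:E)%E.
  rewrite integral_mkcond [RHS]integral_mkcond; apply: eq_integral => x _.
  rewrite !patchE !mem_setE !in_itv /= andbT.
  have [x0|//] := leP 0 x; have [//|bx] := leP x b.
  rewrite Gr ?mulr0// -b2 mulrC ler_wpM2r ?ltW// ltr_sqr ?nnegrE//.
have dF (x : R) : is_derive x 1 (fun x : R => c * x ^+ 2) (2 * c * x).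
  have h := @is_deriveZ R R R _ c x 1 _ (@is_deriveX R R id 2 x 1 _ (is_derive_id x 1)).
  apply: (@is_derive_eq R R R _ _ _ _ _ h).
  by rewrite -![_ *: _]/(_ * _) /= expr1 mulr1 mulrCA mulrA.
have dF1 : derive1 (fun x : R => c * x ^+ 2) = fun x => 2 * c * x.
  by apply/funext => x; rewrite derive1E; have [_ ->] := dF x.
have cF : continuous (fun x : R => c * x ^+ 2).
  by move=> x; apply/differentiable_continuous/derivable1_diffP/(@ex_derive _ _ _ _ _ _ _ (dF x)).
have cF1 : continuous (fun x : R => 2 * c * x).
  move=> x; apply/differentiable_continuous/derivable1_diffP.
  exact: (@ex_derive _ _ _ _ _ _ _ (is_derive_scale (2 * c) x)).
have -> : (\int[mu]_(s in `[0%R, r]) (G s)%:E =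
    \int[mu]_(x in `[0%R, b]) (G (c * x ^+ 2) * (2 * c * x))%:E)%E.
  have := @integration_by_substitution_increasing R (fun x => c * x ^+ 2) G 0 b b0.
  rewrite b2 (_ : c * 0 ^+ 2 = 0) ?expr0n ?mulr0// dF1; apply.
  - move=> x y; rewrite !in_itv /= => /andP[x0 _] /andP[y0 _] xy.
    by rewrite ltr_pM2l// ltr_sqr ?nnegrE.
  - by move=> x _; exact: cF1.
  - exact: (cvgP _ (cvg_at_right_filter (cF1 0))).
  - exact: (cvgP _ (cvg_at_left_filter (cF1 b))).
  - split.
    + by move=> x _; exact: (@ex_derive _ _ _ _ _ _ _ (dF x)).
    + exact: cvg_at_right_filter (cF 0).
    + exact: cvg_at_left_filter (cF b).
  - by apply: continuous_subspaceT.
have mG (A : set R) : measurable A -> measurable_fun A (fun x : R => (`|x| * G (x ^+ 2 * c))%:E).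
  move=> mA; apply/measurable_EFinP; apply: measurable_funTS.
  exact: (continuous_measurable_fun cG2).
rewrite -!ge0_integralZl_EFin//.
- apply: eq_integral => x; rewrite inE /= in_itv /= => /andP[x0 _].
  rewrite -!EFinM; congr EFin; rewrite ger0_norm// (mulrC c); field.
  by rewrite gt_eqF.
- move=> x; rewrite /= in_itv /= => /andP[x0 _]; rewrite lee_fin.
  by rewrite mulr_ge0// !mulr_ge0// ltW.
- apply/measurable_EFinP; apply: measurable_funM.
    apply: measurable_funTS; apply: continuous_measurable_fun => x.
    have cGx : {for c * x ^+ 2, continuous G} by exact: cG.
    exact: (@continuous_comp R R R (fun x : R => c * x ^+ 2) G x (cF x) cGx).
  by apply: measurable_funTS; exact: continuous_measurable_fun.
- by rewrite invr_ge0 ltW.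
- by move=> x _; rewrite lee_fin mulr_ge0.
- exact: mG.
Qed.

Lemma integralT_oneDsqrV : (\int[mu]_(t in [set: R]) ((oneDsqr t)^-1)%:E = pi%:E)%E.
Proof.
rewrite (@ge0_symfun_integralT R (fun t => (oneDsqr t)^-1)).
- rewrite -set_itvcy integral0y_oneDsqr -EFinM; congr EFin.
  by rewrite mulrC divfK.
- by move=> t; rewrite invr_ge0 (le_trans ler01)// oneDsqr_ge1.
- exact: continuous_oneDsqrV.
- by move=> t; rewrite /= /oneDsqr sqrrN.
Qed.

(* The substitution y = |x| t makes the radial variable separate from the slope t. *)
Lemma ge0_integral_radial :
  (\int[plane_measure R]_(p in [set: plane]) (G (sqnorm (to_complex p)))%:E =
   pi%:E * \int[mu]_(s in `[0%R, r]) (G s)%:E)%E.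
Proof.
have mG : measurable_fun setT G by exact: continuous_measurable_fun.
pose f (p : plane) : \bar R := (G (sqnorm (to_complex p)))%:E.
pose g (p : plane) : \bar R := (`|p.1| * G (p.1 ^+ 2 * oneDsqr p.2))%:E.
have mf : measurable_fun setT f.
  by apply/measurable_EFinP; apply: measurableT_comp => //; exact: measurable_sqnorm.
have mg : measurable_fun setT g.
  apply/measurable_EFinP; apply: measurable_funM.
    by apply: measurableT_comp.
  apply: measurableT_comp => //; apply: measurable_funM; first exact: measurable_funX.
  by apply: measurable_funD => //; exact: measurable_funX.
have f0 p : (0 <= f p)%E by rewrite lee_fin.
have g0 p : (0 <= g p)%E by rewrite lee_fin mulr_ge0.
rewrite -[LHS]/((\int[(mu \x mu)%E]_p f p)%E) fubini_tonelli1// /fubini_F.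
transitivity (\int[mu]_x \int[mu]_t g (x, t))%E.
  (* The line x = 0, where the substitution degenerates, is a null set and is removed on both
     sides. *)
  rewrite -(@integral_setD1 _ _ 0 setT); last 2 first.
  - by apply: measurableD.
  - by apply: measurable_funTS; exact: measurable_fun_fubini_tonelli_F.
  rewrite -[RHS](@integral_setD1 _ _ 0 setT); last 2 first.
  - by apply: measurableD.
  - by apply: measurable_funTS; exact: (measurable_fun_fubini_tonelli_F g).
  apply: eq_integral => x; rewrite inE => -[_ /eqP x0].
  exact: integral_line.
rewrite fubini_tonelli//.
(* After exchanging the integrals, the slope t enters only through 1 / (1 + t^2), whose integral
   produces pi. *)
transitivity (\int[mu]_t ((\int[mu]_(s in `[0%R, r]) (G s)%:E) * ((oneDsqr t)^-1)%:E))%E.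
  apply: eq_integral => t _; rewrite /g /= integral_parabola; first exact: muleC.
  by rewrite (lt_le_trans ltr01)// oneDsqr_ge1.
rewrite ge0_integralZl//.
- by rewrite integralT_oneDsqrV muleC.
- by apply/measurable_EFinP; apply: continuous_measurable_fun; exact: continuous_oneDsqrV.
- by apply: integral_ge0 => s _; rewrite lee_fin.
Qed.

End nonnegative.
End Polar.

(** * Radial functions of arbitrary sign, and the integral of the bump density *)

Section Radial.
Variable R : realType.
Local Open Scope classical_set_scope.
Local Open Scope ring_scope.
Local Open Scope complex_scope.
Local Notation mu := (@lebesgue_measure R).
Local Notation plane := (measurableTypeR R * measurableTypeR R)%type.

Lemma ge0_integrable_radial (G : R -> R) (r : R) :
  continuous G -> (forall s, 0 <= G s) -> 0 <= r -> (forall s, r <= s -> G s = 0) ->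
  (plane_measure R).-integrable setT (EFin \o (fun p : plane => G (sqnorm (to_complex p)))) /\
  \int[plane_measure R]_(p in [set: plane]) G (sqnorm (to_complex p)) =
    pi * \int[mu]_(s in `[0, r]) G s.
Proof.
move=> cG G0 r0 Gr; have E := ge0_integral_radial cG G0 r0 Gr.
have iG : mu.-integrable `[0, r] (EFin \o G).
  by apply: integrable_segment => t _; exact: cG.
have fG : (\int[mu]_(s in `[0%R, r]) (G s)%:E)%E \is a fin_num.
  by apply: integrable_fin_num iG.
split; last by rewrite /Rintegral E fineM.
apply/integrableP; split.
  apply/measurable_EFinP; apply: measurableT_comp; last exact: measurable_sqnorm.
  exact: continuous_measurable_fun.
under eq_integral do rewrite /= ger0_norm//.
by rewrite E -(fineK fG) -EFinM ltry.
Qed.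

(** The nonnegative case applies to |g| + g and to |g|, which are continuous and vanish beyond [r];
    [g] is their difference. *)
Lemma integral_radial (g : R -> R) (r : R) :
  continuous g -> 0 <= r -> (forall s, r <= s -> g s = 0) ->
  (plane_measure R).-integrable setT (EFin \o (fun p : plane => g (sqnorm (to_complex p)))) /\
  \int[plane_measure R]_(p in [set: plane]) g (sqnorm (to_complex p)) =
    pi * \int[mu]_(s in `[0, r]) g s.
Proof.
move=> cg r0 gr.
have cN : continuous (fun s => `|g s|).
  move=> s; have cn : {for g s, continuous (fun x : R => `|x|)} by exact: norm_continuous.
  exact: (@continuous_comp R R R g (fun x : R => `|x|) s (cg s) cn).
have cP : continuous (fun s => `|g s| + g s).
  by move=> s; exact: (@continuousD R R^o R (fun s => `|g s|) g s (cN s) (cg s)).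
have [iN eN] :
    (plane_measure R).-integrable setT
      (EFin \o (fun p : plane => `|g (sqnorm (to_complex p))|)) /\
  \int[plane_measure R]_(p in [set: plane]) `|g (sqnorm (to_complex p))| =
    pi * \int[mu]_(s in `[0, r]) `|g s|.
  by apply: (@ge0_integrable_radial (fun s => `|g s|)) => // s rs; rewrite gr// normr0.
have [iP eP] :
    (plane_measure R).-integrable setT
      (EFin \o (fun p : plane => `|g (sqnorm (to_complex p))| + g (sqnorm (to_complex p)))) /\
  \int[plane_measure R]_(p in [set: plane])
      (`|g (sqnorm (to_complex p))| + g (sqnorm (to_complex p))) =
    pi * \int[mu]_(s in `[0, r]) (`|g s| + g s).
  apply: (@ge0_integrable_radial (fun s => `|g s| + g s)) => // s.
    by have := ler_norm (- g s); rewrite normrN; lra.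
  by move=> rs; rewrite gr// normr0 addr0.
split.
  apply: eq_integrable (integrableB measurableT iP iN) => // p _ /=.
  by rewrite -EFinB addrAC subrr add0r.
transitivity (\int[plane_measure R]_(p in [set: plane]) (`|g (sqnorm (to_complex p))| +
    g (sqnorm (to_complex p)) - `|g (sqnorm (to_complex p))|)).
  by apply: eq_Rintegral => p _; rewrite addrAC subrr add0r.
rewrite RintegralB// eP eN -mulrBr -RintegralB//.
- by congr (_ * _); apply: eq_Rintegral => s _; rewrite addrAC subrr add0r.
- by apply: integrable_segment => s _; exact: cP.
- by apply: integrable_segment => s _; exact: cN.
Qed.

Lemma integral_bump_density (r : R) : 0 < r ->
  \int[mu]_(s in `[0, r]) bump_density r s = - flat 0 r.
Proof.
move=> r0; rewrite /Rintegral (@continuous_FTC2 R _ (bump_primitive r))//.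
- rewrite -EFinB /= /bump_primitive subrr subr0 mul0r subr0.
  by rewrite !(flat_le0 _ (lexx 0)) mulr0 subrr sub0r.
- by apply: continuous_subspaceT; exact: continuous_bump_density.
- have cH : continuous (bump_primitive r).
    move=> x; apply/differentiable_continuous/derivable1_diffP.
    exact: (@ex_derive _ _ _ _ _ _ _ (is_derive_bump_primitive r x)).
  split.
  + by move=> x _; exact: (@ex_derive _ _ _ _ _ _ _ (is_derive_bump_primitive r x)).
  + exact: cvg_at_right_filter (cH 0).
  + exact: cvg_at_left_filter (cH r).
- by move=> x _; rewrite derive1E; have [_ ->] := is_derive_bump_primitive r x.
Qed.

End Radial.

(** * The curvature current *)

Section Current.
Variable R : realType.
Local Open Scope classical_set_scope.
Local Open Scope ring_scope.
Local Open Scope complex_scope.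
Local Notation plane := (measurableTypeR R * measurableTypeR R)%type.

Lemma flat0_homo (x y : R) : x <= y -> flat 0 x <= flat 0 y.
Proof.
move=> xy; have [x0|x0] := leP x 0; first by rewrite flat_le0// flat_ge0.
have y0 := lt_le_trans x0 xy.
by rewrite /flat x0 y0 !expr0 invr1 !mul1r ler_expR lerN2 lef_pV2.
Qed.

Lemma bump_bound (t : R) (z : R[i]) : 0 <= t ->
  `|complex.Re (bump (t ^+ 2) z)| <= t * flat 0 (t ^+ 2) /\
  `|complex.Im (bump (t ^+ 2) z)| <= t * flat 0 (t ^+ 2).
Proof.
move=> t0; case: z => x y; rewrite /bump /= !mulr0 subr0 add0r.
set s := sqnorm _.
have [st|ts] := leP (t ^+ 2) s.
  by rewrite flat_le0 ?subr_le0// !mulr0 normr0; split; rewrite mulr_ge0// flat_ge0.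
have fl : flat 0 (t ^+ 2 - s) <= flat 0 (t ^+ 2).
  by apply: flat0_homo; rewrite gerBl sqnorm_ge0.
have bd (a : R) : a ^+ 2 <= s -> `|a| <= t.
  have [//|ta as_] := leP `|a| t.
  have : t ^+ 2 < `|a| ^+ 2 by rewrite ltr_sqr ?nnegrE.
  rewrite real_normK ?num_real//; lra.
have xs : `|x| <= t by apply: bd; rewrite /s /sqnorm /= lerDl sqr_ge0.
have ys : `|y| <= t by apply: bd; rewrite /s /sqnorm /= lerDr sqr_ge0.
by split; rewrite normrM (ger0_norm (flat_ge0 _ _)) ler_pM// flat_ge0.
Qed.

Lemma measurable_bump (r : R) : measurable_fun setT (re_part (bump r)) /\
  measurable_fun setT (im_part (bump r)).
Proof.
have mfl : measurable_fun setT (fun p : plane => flat 0 (r - sqnorm (to_complex p))).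
  apply: measurableT_comp; first by apply: continuous_measurable_fun; exact: continuous_flat.
  by apply: measurable_funB => //; exact: measurable_sqnorm.
split.
  rewrite (_ : re_part _ = fun p : plane => p.1 * flat 0 (r - sqnorm (to_complex p))).
    by apply: measurable_funM.
  by apply/funext => p; rewrite /re_part /bump /= mulr0 subr0.
rewrite (_ : im_part _ = fun p : plane => p.2 * flat 0 (r - sqnorm (to_complex p))).
  by apply: measurable_funM.
by apply/funext => p; rewrite /im_part /bump /= mulr0 add0r.
Qed.

(** The candidate measures are finite on compact sets only, so the integral over the disc is first
    brought back to a compact set supporting the integrand. *)
Lemma normr_Rintegral_bound (m : {measure set plane -> \bar R}) (A K : set plane)
    (f : plane -> R) (M : R) :
  measurable A -> measurable K -> K `<=` A -> (m K < +oo)%E -> measurable_fun setT f ->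
  (forall p, ~ K p -> f p = 0) -> (forall p, `|f p| <= M) ->
  `|\int[m]_(p in A) f p| <= M * fine (m K).
Proof.
move=> mA mK KA mKoo mf fK fM.
have -> : \int[m]_(p in A) f p = \int[m]_(p in K) f p.
  rewrite Rintegral_mkcond [RHS]Rintegral_mkcond; apply: eq_Rintegral => p _.
  rewrite !patchE; case: ifPn; case: ifPn => //.
    by move=> pK _; rewrite fK// => /mem_set; apply/negP.
  by rewrite !inE => /KA pA; rewrite notin_setE.
have cst_int (c : R) : m.-integrable K (EFin \o (fun=> c)).
  apply/integrableP; split; first exact/measurable_EFinP.
  by under eq_integral do rewrite /=; rewrite integral_cst// lte_mul_pinfty.
have fi : m.-integrable K (EFin \o f).
  apply: (le_integrable mK _ _ (cst_int M)).
    by apply/measurable_EFinP; exact: measurable_funTS.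
  by move=> p _ /=; rewrite lee_fin (le_trans (fM p))// ler_norm.
apply: le_trans (le_normr_Rintegral mK fi) _.
rewrite -Rintegral_cst//; apply: le_Rintegral => //.
exact: (integrable_abse fi).
Qed.

Lemma current_bump (r : R) : 0 < r -> r < 1 ->
  complex.Re (distr_dzbar (distr_dz (distr_of_fun unit_disc (fun z => z^-1))) (bump r)) =
  - (pi * flat 0 r).
Proof.
move=> r0 r1; rewrite /distr_dzbar /distr_dz opprK /distr_of_fun /cintegral.
pose f := re_part (fun z => z^-1 * wirtinger_dz (wirtinger_dzbar (bump r)) z).
rewrite -[LHS]/(\int[plane_measure R]_(p in to_plane unit_disc) f p).
(* By convention 0^-1 = 0, so the integrand is 0 at the origin, where the density in general is
   not. *)
have fE p : f p = if p == (0, 0) then 0 else bump_density r (sqnorm (to_complex p)).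
  rewrite /f /re_part bump_laplacian mulrA.
  case: p => x y; rewrite xpair_eqE; case: ifPn => [/andP[/eqP-> /eqP->]|xy].
    by rewrite (_ : to_complex (0, 0) = 0)// mulr0 mul0r.
  rewrite mulVf ?mul1r//; apply: contra xy => /eqP[-> ->].
  by rewrite !eqxx.
rewrite -mulrN -(integral_bump_density r0).
have [di <-] := integral_radial (@continuous_bump_density R r) (ltW r0) (@bump_density0 _ r).
have m0 : measurable ([set (0, 0)] : set plane).
  rewrite (_ : [set _] = [set 0 : R] `*` [set 0 : R]); last first.
    by apply/seteqP; split=> -[x y] /= [-> ->].
  exact: measurableX.
(* The domain changes from the disc to the punctured plane: the density vanishes outside the disc
   because r < 1, and the origin, where the two integrands may differ, is a null set. *)
transitivity (\int[plane_measure R]_(p in ~` [set (0, 0)])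
  bump_density r (sqnorm (to_complex p))).
  rewrite Rintegral_mkcond [RHS]Rintegral_mkcond; apply: eq_Rintegral => p _.
  rewrite !patchE -[point]/(0 : R) fE; have [->|p0] := eqVneq p (0, 0).
    by rewrite (_ : (_ \in ~` _) = false) ?if_same//; apply/negbTE; rewrite notin_setE /=; apply.
  rewrite [X in _ = if X then _ else _]mem_set; last exact/eqP.
  case: ifPn => //; rewrite notin_setE /to_plane /= unit_discE => /negP; rewrite -leNgt => pD.
  by rewrite bump_density0// (le_trans (ltW r1)).
rewrite /Rintegral (negligible_integral m0 measurableT di) ?setTD//.
rewrite (_ : [set _] = [set 0 : R] `*` [set 0 : R]); last first.
  by apply/seteqP; split=> -[x y] /= [-> ->].
by rewrite /plane_measure /= product_measure1E//= lebesgue_measure_set1 mul0e.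
Qed.

Lemma not_measure_coefficient :
  ~ has_measure_coefficient unit_disc
      (distr_dzbar (distr_dz (distr_of_fun (@unit_disc R) (fun z => z^-1)))).
Proof.
move=> [m mfin mE].
have q1 : 1 / 4 < 1 :> R by lra.
pose K : set R[i]^o := disc (1 / 4).
have KD : K `<=` unit_disc by exact: disc_sub_unit.
pose C := \sum_(k < 4) fine (m k (to_plane K)).
have C0 : 0 <= C by apply: sumr_ge0 => k _; exact: fine_ge0.
(* The first bound puts the support of the test function, of radius [t], inside [K]; the second
   gives t C < 1/2, which pi exceeds. The masses in [C] are those of the fixed set [K], so [t] can
   be chosen after them. *)
pose t := Num.min (1 / 2) ((2 * C + 1)^-1).
have D0 : 0 < 2 * C + 1 by rewrite ltr_wpDl// mulr_ge0.
have t0 : 0 < t by rewrite lt_min invr_gt0 D0 andbT; lra.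
have t2 : t <= 1 / 2 by rewrite ge_min lexx.
have tC : t * (2 * C + 1) <= 1 by rewrite -ler_pdivlMr// div1r ge_min lexx orbT.
have r0 : 0 < t ^+ 2 by rewrite exprn_gt0.
have r4 : t ^+ 2 <= 1 / 4.
  have -> : 1 / 4 = (1 / 2) ^+ 2 :> R by field.
  by rewrite ler_sqr ?nnegrE; lra.
have rD : disc (t ^+ 2) `<=` K by move=> z; rewrite /disc /= => /le_trans; apply.
have tf : test_function unit_disc (bump (t ^+ 2)).
  apply: bump_test_function; first by lra.
  by move=> z /rD /KD.
have := current_bump r0 (le_lt_trans r4 q1); rewrite mE// raddf_sum /= => E.
pose M := t * flat 0 (t ^+ 2).
have [mr mi] := measurable_bump (t ^+ 2).
have out p : ~ to_plane K p -> bump (t ^+ 2) (to_complex p) = 0.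
  move=> pK; rewrite /bump flat_le0 ?mulr0// subr_le0 leNgt; apply/negP => pr.
  by apply: pK; apply: rD; exact: ltW.
have B (k : 'I_4) : `|complex.Re ('i ^+ k * cintegral (m k) unit_disc (bump (t ^+ 2)))| <=
    M * fine (m k (to_plane K)).
  have kfin := mfin k K (compact_disc (ltW q1)) KD.
  have mK := measurable_disc (1 / 4 : R).
  have Br : `|complex.Re (cintegral (m k) unit_disc (bump (t ^+ 2)))| <=
      M * fine (m k (to_plane K)).
    apply: normr_Rintegral_bound => //.
    - exact: measurable_unit_disc.
    - by move=> p /KD.
    - by move=> p /out pK; rewrite /re_part pK.
    - by move=> p; have [] := bump_bound (to_complex p) (ltW t0).
  have Bi : `|complex.Im (cintegral (m k) unit_disc (bump (t ^+ 2)))| <=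
      M * fine (m k (to_plane K)).
    apply: normr_Rintegral_bound => //.
    - exact: measurable_unit_disc.
    - by move=> p /KD.
    - by move=> p /out pK; rewrite /im_part pK.
    - by move=> p; have [] := bump_bound (to_complex p) (ltW t0).
  move: (cintegral _ _ _) Br Bi => [a b] /= Br Bi.
  (* Multiplication by i^k exchanges real and imaginary parts up to sign, which is why both were
     bounded. *)
  by case: k {kfin mK} Br Bi => [[|[|[|[|k]]]]//= klt]; rewrite !ler_norml => Br Bi; lra.
have fl0 : 0 < flat 0 (t ^+ 2).
  by rewrite /flat r0 expr0 invr1 mul1r expR_gt0.
have : pi * flat 0 (t ^+ 2) <= M * C.
  have -> : pi * flat 0 (t ^+ 2) = `|- (pi * flat 0 (t ^+ 2))|.
    by rewrite normrN ger0_norm// mulr_ge0 ?flat_ge0// pi_ge0.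
  rewrite -E (le_trans (ler_norm_sum _ _ _))// /C mulr_sumr.
  by apply: ler_sum => k _; exact: B.
rewrite /M mulrAC ler_pM2r// => pitC.
have := @pi_ge2 R; lra.
Qed.

End Current.

Theorem theorem1p3 (R : realType) (h : R[i] -> 'M[R[i]]_2)
  (hE : forall z : R[i], unit_disc z ->
     h z = mx2 (1 + `|z| ^+ 2) z (Num.conj z) (`|z| ^+ 2)) :
  [/\ singular_hermitian_metric unit_disc h,
      griffiths_negative unit_disc h,
      forall z : R[i], unit_disc z -> z != 0 ->
        h z \in unitmx /\
        connection_matrix h z = mx2 z^-1 0 (- (z ^+ 2)^-1) z^-1,
      ~ locally_integrable_mx unit_disc (connection_matrix h) &
      ~ has_measure_coefficients unit_disc
          (dbar_mx (pv_current_mx unit_disc (connection_matrix h)))].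
Proof.
have hE' z : unit_disc z -> h z = hmx z by move=> /hE.
split.
- exact: hermitian_hmx.
- exact: griffiths_hmx.
- by move=> z zD z0; split; [rewrite hE'// hmx_unit|exact: connection_hmx].
- exact: not_locally_integrable.
- by move=> /(_ 1 0); exact: not_measure_coefficient.
Qed.
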